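(* Let $\mathbf{F}$ be a continuous bundle random dynamical system over $(\Omega,\mathcal{F},\mathbb{P},G)$ with compact metric state space $X$, and let $\mathbf{D}=\{d_F:F\in\mathcal{F}_G\}\subseteq\mathbf{L}^1_{\mathcal{E}}(\Omega,C(X))$ be a strongly sub-additive $G$-invariant family. Then for any sequence $\{\nu_n:n\in\mathbb{N}\}\subseteq\mathcal{P}_{\mathbb{P}}(\mathcal{E})$, setting $\mu_n=\frac{1}{|F_n|}\sum_{g\in F_n}g\nu_n$ for each $n\in\mathbb{N}$, there exists a subsequence $\{n_j:j\in\mathbb{N}\}\subseteq\mathbb{N}$ such that $\{\mu_{n_j}:j\in\mathbb{N}\}$ converges to some $\mu\in\mathcal{P}_{\mathbb{P}}(\mathcal{E})$ (and hence $\mu\in\mathcal{P}_{\mathbb{P}}(\mathcal{E},G)$) with $$\limsup_{j\to\infty}\frac{1}{|F_{n_j}|}\int_{\mathcal{E}}d_{F_{n_j}}(\omega,x)\,d\nu_{n_j}(\omega,x)\le\mu(\mathbf{D}).$$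
   Context: $G$ is an infinite countable discrete amenable group with identity $e_G$; $\mathcal{F}_G$ is the set of non-empty finite subsets of $G$; $\{F_n\}_{n\in\mathbb{N}}\subseteq\mathcal{F}_G$ is a fixed F\o lner sequence ($|gF_n\Delta F_n|/|F_n|\to0$ for every $g\in G$) with $e_G\in F_1\subsetneq F_2\subsetneq\cdots$. $(\Omega,\mathcal{F},\mathbb{P})$ is a Lebesgue (in particular complete) probability space on which $G$ acts by invertible measure-preserving transformations, $e_G$ acting as the identity. $X$ is a compact metric space with Borel $\sigma$-algebra $\mathcal{B}_X$, $\mathcal{E}\in\mathcal{F}\times\mathcal{B}_X$, $\mathcal{E}_\omega=\{x:(\omega,x)\in\mathcal{E}\}$. A continuous bundle random dynamical system over $(\Omega,\mathcal{F},\mathbb{P},G)$ is a family $\mathbf{F}=\{F_{g,\omega}:\mathcal{E}_\omega\to\mathcal{E}_{g\omega}\mid g\in G,\omega\in\Omega\}$ such that $F_{e_G,\omega}=\mathrm{id}$; $(\omega,x)\mapsto F_{g,\omega}(x)$ is measurable on $\mathcal{E}$ for each $g$; $F_{g_2,g_1\omega}\circ F_{g_1,\omega}=F_{g_2g_1,\omega}$ for all $\omega,g_1,g_2$; and for $\mathbb{P}$-a.e. $\omega$, $\mathcal{E}_\omega$ is non-empty compact and every $F_{g,\omega}$ is continuous. $G$ acts on $\mathcal{E}$ by $g(\omega,x)=(g\omega,F_{g,\omega}x)$. $\mathcal{P}_{\mathbb{P}}(\mathcal{E})$: probability measures $\mu$ on $\Omega\times X$ with marginal $\mathbb{P}$ on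 $\Omega$ and $\mu(\mathcal{E})=1$; $\mathcal{P}_{\mathbb{P}}(\mathcal{E},G)$: its $G$-invariant elements. $\mathbf{L}^1_{\mathcal{E}}(\Omega,C(X))$: real functions $f$ on $\mathcal{E}$, measurable in $(\omega,x)$, continuous in $x\in\mathcal{E}_\omega$ for fixed $\omega$, with $\int_\Omega\sup_{x\in\mathcal{E}_\omega}|f(\omega,x)|\,d\mathbb{P}(\omega)<\infty$ (functions at distance $0$ identified). Convergence $\mu_n\to\mu$ in $\mathcal{P}_{\mathbb{P}}(\mathcal{E})$ means $\int f\,d\mu_n\to\int f\,d\mu$ for all such $f$. $\mathbf{D}$ is *strongly sub-additive* if for $\mathbb{P}$-a.e. $\omega$, $d_{E\cup F}(\omega,x)+d_{E\cap F}(\omega,x)\le d_E(\omega,x)+d_F(\omega,x)$ for all $E,F\in\mathcal{F}_G$ and $x\in\mathcal{E}_\omega$ (with $d_\emptyset=0$); it is *$G$-invariant* if for $\mathbb{P}$-a.e. $\omega$, $d_{Fg}(\omega,x)=d_F(g(\omega,x))$ for all $F\in\mathcal{F}_G$, $g\in G$, $x\in\mathcal{E}_\omega$. For such $\mathbf{D}$ and $\mu\in\mathcal{P}_{\mathbb{P}}(\mathcal{E},G)$, $\mu(\mathbf{D})=\lim_n\frac{1}{|F_n|}\int_{\mathcal{E}}d_{F_n}\,d\mu\in[-\infty,\infty)$; the limit exists. *)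

(* Defs.v *)
From HB Require Import structures.
From mathcomp Require Import all_boot all_order all_algebra.
From mathcomp Require Import finmap.
From mathcomp Require Import all_classical all_reals all_analysis.
From mathcomp Require Import measurable_realfun.

Set Implicit Arguments.
Unset Strict Implicit.
Unset Printing Implicit Defensive.

Import Order.TTheory GRing.Theory Num.Theory.
Import numFieldNormedType.Exports.

Local Open Scope classical_set_scope.
Local Open Scope ring_scope.

(* Generated sigma-algebras are only available on pointed types, which
   [metricType] is not. *)
#[short(type="pmetricType")]
HB.structure Definition PMetric (K : numDomainType) :=
  {M of Metric K M & Pointed M}.

Notation borel X := (g_sigma_algebraType (@open X)).

Section folner.
Context (R : realType) (G : groupType).
Implicit Types (K : {fset G}) (g : G).

Definition ltrans g K : {fset G} := [fset (g * h)%g | h in K]%fset.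
Definition rtrans K g : {fset G} := [fset (h * g)%g | h in K]%fset.
Definition fsymdiff K L : {fset G} := ((K `\` L) `|` (L `\` K))%fset.

Definition folner (Fn : nat -> {fset G}) : Prop :=
  (forall n, Fn n != fset0) /\
  forall g, (#|` fsymdiff (ltrans g (Fn n)) (Fn n)|%:R / #|` Fn n|%:R : R)
    @[n --> \oo] --> (0 : R).

End folner.

(* The measure on the line made of Lebesgue measure on [0, c] together with an
   atom of mass [a n] at each point n + 2. *)
Definition interval_atoms (R : realType) (c : R) (a : nat -> R)
    (A : set (measurableTypeR R)) : \bar R :=
  (lebesgue_measure (A `&` `[0%R, c]) +
   \sum_(0 <= n <oo) (a n)%:E * \d_(n.+2%:R : measurableTypeR R) A)%E.

(* Rokhlin's definition: complete, and isomorphic mod 0 to (the completion of)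
   an interval with Lebesgue measure together with countably many atoms.
   [completed_algebra_gen m] is the family of sets [B `|` N] with [B] measurable
   and [N] m-negligible, i.e. the sigma-algebra completed with respect to [m].
   The last clause at [B = setT] forces the model to have total mass 1. *)
Definition lebesgue_space (R : realType) d (Omega : measurableType d)
    (P : probability Omega R) : Prop :=
  measure_is_complete P /\
  exists (c : R) (a : nat -> R) (Omega0 : set Omega)
    (Y0 : set (measurableTypeR R)) (phi : Omega -> measurableTypeR R),
    [/\ 0 <= c /\ forall n, 0 <= a n,
        measurable Omega0 /\ P Omega0 = 1%E,
        measurable Y0 /\ set_bij Omega0 Y0 phi,
        forall A, A `<=` Omega0 ->
          (measurable A <->
           completed_algebra_gen (interval_atoms c a) (phi @` A)) &
        forall B, measurable B ->
          P (Omega0 `&` phi @^-1` B) = interval_atoms c a B].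

Record mp_action (G : groupType) (R : realType) d (Omega : measurableType d)
    (P : probability Omega R) := MPAction {
  act :> G -> Omega -> Omega;
  act1 : forall w, act 1%g w = w;
  actM : forall g h w, act (g * h)%g w = act g (act h w);
  measurable_act : forall g, measurable_fun [set: Omega] (act g);
  act_preserving : forall g A, measurable A -> P (act g @^-1` A) = P A }.

Definition fiber (T X : Type) (E : set (T * X)) (w : T) : set X :=
  [set x | E (w, x)].

(* The maps F_(g, w) : E_w -> E_(g w) are encoded by a total function
   [rmap g w], whose values outside [fiber bundle w] are never used. *)
Record bundle_rds (G : groupType) (R : realType) d (Omega : measurableType d)
    (P : probability Omega R) (T : mp_action G P) (X : pmetricType R) :=
  BundleRDS {
  bundle : set (Omega * borel X);
  measurable_bundle : measurable bundle;
  rmap : G -> Omega -> X -> X;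
  rmap_fiber : forall g w x,
    bundle (w, x) -> bundle (T g w, rmap g w x);
  measurable_rmap : forall g,
    measurable_fun bundle (fun p => rmap g p.1 p.2 : borel X);
  rmap1 : forall w x, bundle (w, x) -> rmap 1%g w x = x;
  rmapM : forall g1 g2 w x, bundle (w, x) ->
    rmap (g2 * g1)%g w x = rmap g2 (T g1 w) (rmap g1 w x);
  bundle_regular : {ae P, forall w,
    [/\ fiber bundle w !=set0 , compact (fiber bundle w : set X) &
        forall g, {within (fiber bundle w : set X), continuous (rmap g w)}]} }.

Section bundle_rds_theory.
Context (G : groupType) (R : realType) d (Omega : measurableType d)
  (P : probability Omega R) (T : mp_action G P) (X : pmetricType R)
  (S : bundle_rds T X).
Local Notation E := (bundle S).
Local Notation OX := (Omega * borel X)%type.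

Definition skew (g : G) (p : OX) : OX := (T g p.1, rmap S g p.1 p.2).

Definition in_PPE (mu : set OX -> \bar R) : Prop :=
  (forall A, measurable A -> mu (fst @^-1` A) = P A) /\ mu E = 1%E.

(* [skew g] is only meaningful on the bundle, hence the intersection; for [nu]
   carried by the bundle this is the image measure of [nu] by [g]. *)
Definition gpush (g : G) (nu : set OX -> \bar R) : set OX -> \bar R :=
  fun A => nu (E `&` skew g @^-1` A).

Definition in_PPEG (mu : set OX -> \bar R) : Prop :=
  in_PPE mu /\ forall g A, measurable A -> gpush g mu A = mu A.

Definition gavg (K : {fset G}) (nu : set OX -> \bar R) : set OX -> \bar R :=
  fun A => ((#|` K|%:R^-1)%:E * \sum_(g <- K) gpush g nu A)%E.

Lemma measurable_skew g : measurable_fun E (skew g).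
Proof.
have := @measurable_prod_measurableType _ _ Omega (borel X).
move/(@measurability _ _ OX OX E (skew g) _); apply.
move=> _ [_ [A mA [B mB <-]] <-].
have mE := measurable_bundle S.
have mact : measurable_fun E (fun p : OX => T g p.1).
  apply: measurable_funTS.
  exact: measurableT_comp (@measurable_act _ _ _ _ _ T g) measurable_fst.
have := measurableI _ _ (mact mE A mA) (@measurable_rmap _ _ _ _ _ _ _ S g mE _ mB).
congr (measurable _); apply/seteqP; split => -[w x] /=.
  by move=> [[? ?] [? ?]].
by move=> [? [? ?]].
Qed.

Section gpush_measure.
Variables (g : G) (nu : {measure set OX -> \bar R}).
Local Open Scope ereal_scope.

Let gpush0 : gpush g nu set0 = 0.
Proof. by rewrite /gpush preimage_set0 setI0 measure0. Qed.

Let gpush_ge0 A : 0 <= gpush g nu A.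
Proof. exact: measure_ge0. Qed.

Let gpush_sigma_additive : semi_sigma_additive (gpush g nu).
Proof.
move=> F mF tF mUF; rewrite /gpush preimage_bigcup setI_bigcupr.
apply: measure_semi_sigma_additive.
- by move=> n; exact: measurable_skew (measurable_bundle S) _ (mF n).
- apply/trivIsetP => /= i j _ _ ij; rewrite setIACA -preimage_setI.
  by move/trivIsetP : tF => /(_ _ _ _ _ ij) ->//; rewrite preimage_set0 setI0.
- rewrite -setI_bigcupr -preimage_bigcup.
  exact: measurable_skew (measurable_bundle S) _ mUF.
Qed.

HB.instance Definition _ := isMeasure.Build _ _ _ (gpush g nu)
  gpush0 gpush_ge0 gpush_sigma_additive.

End gpush_measure.

Section gavg_measure.
Variables (K : {fset G}) (nu : {measure set OX -> \bar R}).
Local Open Scope ereal_scope.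

Let gavgE : gavg K nu =
  mscale ((#|` K|%:R^-1)%:nng)%R
    (msum (fun i => gpush (nth 1%g K i) nu) #|` K|).
Proof.
apply/funext => A; rewrite /gavg /mscale /msum /=; congr (_ * _).
by rewrite (big_nth 1%g) big_mkord.
Qed.

Let gavg0 : gavg K nu set0 = 0.
Proof. by rewrite gavgE measure0. Qed.

Let gavg_ge0 A : 0 <= gavg K nu A.
Proof. by rewrite gavgE measure_ge0. Qed.

Let gavg_sigma_additive : semi_sigma_additive (gavg K nu).
Proof. by rewrite gavgE; exact: measure_semi_sigma_additive. Qed.

HB.instance Definition _ := isMeasure.Build _ _ _ (gavg K nu)
  gavg0 gavg_ge0 gavg_sigma_additive.

End gavg_measure.

(* Integrability includes the measurability of the supremum, which holds by
   the measurable projection theorem when [P] is complete; empty fibers, where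
   the supremum is -oo, only occur on a P-negligible set. Elements are actual
   functions: those agreeing on almost all fibers are not identified. *)
Definition L1E (f : OX -> R) : Prop :=
  [/\ measurable_fun E f,
      forall w, {within (fiber E w : set X), continuous (fun x : X => f (w, x))} &
      P.-integrable [set: Omega]
        (fun w => ereal_sup [set `|f (w, x)|%:E | x in fiber E w])].

Definition cvg_PPE (mu_ : nat -> {measure set OX -> \bar R})
    (mu : {measure set OX -> \bar R}) : Prop :=
  forall f, L1E f ->
    (\int[mu_ n]_(p in E) (f p)%:E)%E @[n --> \oo]
      --> (\int[mu]_(p in E) (f p)%:E)%E.

(* Families (d_F) indexed by the non-empty finite subsets of the group are
   encoded by functions on all finite subsets whose value at the empty set is
   never used. *)
Implicit Types (D : {fset G} -> OX -> R) (K L : {fset G}).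

Definition strongly_subadditive D : Prop :=
  {ae P, forall w, forall K L x, K != fset0 -> L != fset0 -> E (w, x) ->
    D (K `|` L)%fset (w, x) +
      (if (K `&` L)%fset == fset0 then 0 else D (K `&` L)%fset (w, x))
    <= D K (w, x) + D L (w, x)}.

Definition ginvariant D : Prop :=
  {ae P, forall w, forall K g x, K != fset0 -> E (w, x) ->
    D (rtrans K g) (w, x) = D K (skew g (w, x))}.

(* Only meaningful for a G-invariant [mu], for which the limit exists. *)
Definition mean_value (Fn : nat -> {fset G}) D
    (mu : {measure set OX -> \bar R}) : \bar R :=
  limn (fun n =>
    ((#|` Fn n|%:R^-1)%:E * \int[mu]_(p in E) (D (Fn n) p)%:E)%E).

End bundle_rds_theory.

(* Main.v *)
(* The proof has two independent parts.

   Compactness. A Lebesgue space is countably generated mod 0 and X is coded in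
   {0,1}^nat by a sequence of open sets, so a subsequence of mu_n converges on
   every product of a measurable subset of Omega and a cell of the coding. The
   limits define a finitely additive function on Omega * {0,1}^nat, countably
   additive because {0,1}^nat is compact, and its image mu under the map sending
   a code to the limit of its cells satisfies
   \int f dmu <= liminf \int f dmu_n for every nonnegative measurable f that is
   lower semicontinuous in x: the infima of f over the cells are measurable by
   the projection theorem (P is complete) and increase to f in the limit. With
   f = 0 on E and +oo elsewhere this gives mu(E) = 1, and with f = N + h and
   f = N - h it gives \int h dmu_n -> \int h dmu. Invariance of mu follows from
   the Folner property.

   Upper bound. A submodular d with d(fset0) = 0 dominates, on the subsets of A,
   an additive function equal to d at A. Covering each point of A by the |K|
   translates K g that contain it yields
   |K| d_A <= \sum_(g in A) d_K o g + (an error from the g where K g crosses the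
   boundary of A). Integrating, dividing by |K||A| and letting A run through the
   Folner sequence gives limsup |F_n|^-1 \int d_(F_n) dnu_n <= |K|^-1 \int d_K dmu
   for every K; finally K runs through the Folner sequence. *)
Require Import Defs.
From HB Require Import structures.
From mathcomp Require Import all_boot all_order all_algebra.
From mathcomp Require Import finmap.
From mathcomp Require Import all_classical all_reals all_analysis.
From mathcomp Require Import measurable_realfun.

Set Implicit Arguments.
Unset Strict Implicit.
Unset Printing Implicit Defensive.

Import Order.TTheory GRing.Theory Num.Theory.
Import numFieldNormedType.Exports.

Local Open Scope classical_set_scope.
Local Open Scope ring_scope.

(** [Omega] has no topology and the bundle is only measurable, so weak compactness cannot be applied
    on [Omega * X] directly. It is replaced by the common marginal: on products [A * C] every [mu_n]
    is below [P A], uniformly in [n]. This turns convergence for countably many [A] into convergence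
    for all, and makes the finitely additive limit countably additive. The coding of [X] is not
    continuous, and a limit of codes need not be the code of a point; mass may accumulate there, so
    indicators of cells do not pass to the limit. Integrands lower semicontinuous in [x] still
    satisfy one inequality, hence the detour through them. In the upper bound the [nu_n] are not
    invariant; the averages appear because invariance of the family turns [d_(K g)] into [d_K]
    composed with [g]. The error is [o(|F_n|)]: a translate crossing the boundary of [A] gives a
    point of some symmetric difference of [k^-1 A] and [A], and a translate cut by [A] is a
    translate of one of the finitely many subsets of [K], which gives an integrable bound whose
    integral does not depend on [g]. *)

(** * Ultrafilter limits and a common convergent subsequence *)

(** For an ultrafilter a cluster point is a limit: if the preimage of a neighbourhood were not in
    [U], its complement would be, and would miss that neighbourhood. *)
Lemma ultra_compact_cvg {I : Type} {T : topologicalType} (U : set_system I)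
    (A : set T) (f : I -> T) : UltraFilter U -> compact A -> U (f @^-1` A) ->
  exists2 p, A p & f @ U --> p.
Proof.
move=> UU cA UA; have [p [Ap clp]] := cA _ (fmap_proper_filter f ultra_proper) UA.
exists p => // V Vp; have [//|UC] := in_ultra_setVsetC (f @^-1` V) UU.
by have [y []] := clp (~` V) V UC Vp.
Qed.

Lemma ultra_bounded_nat {I : Type} (U : set_system I) (f : I -> nat) b :
  UltraFilter U -> U [set i | (f i <= b)%N] -> exists2 v, (v <= b)%N & U [set i | f i = v].
Proof.
move=> UU; elim: b => [|b IH] Ub.
  by exists 0%N => //; apply: filterS Ub => i /=; rewrite leqn0 => /eqP.
have [U1|U1] := in_ultra_setVsetC [set i | f i = b.+1] UU; first by exists b.+1.
have [|v vb Uv] := IH; last by exists v => //; exact: leqW.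
apply: filterS2 Ub U1 => i /= ib /eqP nb.
by rewrite -ltnS ltn_neqAle nb ib.
Qed.

Lemma ultra_above_oo : exists U : set_system nat, UltraFilter U /\ \oo `<=` U.
Proof. exact: ultraFilterLemma. Qed.

(** One ultrafilter above [\oo] provides all the limits [L k] at once. Finitely many conditions of
    closeness to them hold together at arbitrarily large indices, so [n_ j] can be chosen to serve
    the rows up to [j] with tolerance [1/(j+1)]. *)
Lemma common_subsequence (R : realType) (a : nat -> nat -> R) :
  (forall k n, 0 <= a k n <= 1) ->
  exists2 n_, increasing_seq n_ & forall k, cvgn (a k \o n_).
Proof.
move=> a01; have [U [UU ooU]] := ultra_above_oo.
have /choice[L aL] : forall k, exists L : R, a k @ U --> L.
  move=> k; have [|L _ aL] := ultra_compact_cvg (f := a k) UU (@segment_compact R 0 1).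
    by apply: filterS filterT => n _ /=; rewrite in_itv/=.
  by exists L.
have pickP j m : exists n, (m < n)%N /\
    forall k, (k <= j)%N -> `|L k - a k n| < j.+1%:R^-1.
  have /filter_ex[n [mn /= h]] : U ([set n | (m < n)%N] `&`
      [set n | forall k : 'I_j.+1, `|L k - a k n| < j.+1%:R^-1]).
    apply: filterI; first by apply: ooU; exists m.+1.
    by apply: filter_forall => k; move/cvgrPdist_lt : (aL k); exact.
  by exists n; split => // k kj; exact: h (Ordinal (kj : k < j.+1)%N).
have /choice[f fP] : forall x : nat * nat, exists n : nat, (x.2 < n)%N /\
    forall k, (k <= x.1)%N -> `|L k - a k n| < x.1.+1%:R^-1 by move=> [j m]; exact: pickP.
pose fix n_ j := if j is i.+1 then f (j, n_ i) else f (0%N, 0%N).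
exists n_.
  apply/increasing_seqP => j; exact: (fP (j.+1, n_ j)).1.
move=> k; apply/cvg_ex; exists (L k); apply/cvgrPdist_lt => e e0.
have h j : (k <= j)%N -> `|L k - a k (n_ j)| < j.+1%:R^-1.
  case: j => [|j] kj; [exact: (fP (0%N, 0%N)).2|exact: (fP (j.+1, n_ j)).2].
near=> j; apply: lt_trans (h j _) _; first by near: j; exists k.
by near: j; exact: near_infty_natSinv_lt (PosNum e0).
Unshelve. all: by end_near. Qed.

(** * Souslin sets and measurable projection *)

Section suslin.
Context d (T : measurableType d) (X : topologicalType).
Implicit Types (H : set (T * X)) (m k n i : nat) (al be : nat -> nat).

(* The [k]-th condition depends only on the first [b k] coordinates of the
   parameter. *)
Definition suslin H := exists (A : nat -> (nat -> nat) -> set T)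
    (K : nat -> (nat -> nat) -> set X) (b : nat -> nat),
  [/\ forall k al, measurable (A k al) /\ closed (K k al),
      forall k al be, (forall i, (i < b k)%N -> al i = be i) ->
        A k al = A k be /\ K k al = K k be &
      H = [set p | exists al, forall k, A k al p.1 /\ K k al p.2]].

Lemma suslin_rect (A : set T) (K : set X) :
  measurable A -> closed K -> suslin (A `*` K).
Proof.
move=> mA cK; exists (fun _ _ => A), (fun _ _ => K), (fun=> 0%N); split => //.
apply/seteqP; split => [p [Ap Kp]|p [_ /(_ 0%N)]] //=.
Qed.

Let dec n : nat * nat := odflt (0%N, 0%N) (choice.unpickle n).
Let decK mk : dec (choice.pickle mk) = mk. Proof. by rewrite /dec choice.pickleK. Qed.

(** The first coordinate of the parameter selects [m] and the remaining ones form a parameter for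
    [H m]; the condition coded by [(m, k)] is void when another index is selected. *)
Lemma suslin_bigcup (H : nat -> set (T * X)) :
  (forall m, suslin (H m)) -> suslin (\bigcup_m H m).
Proof.
move=> /choice[A] /choice[K] /choice[b] h.
exists (fun n al => if al 0%N == (dec n).1 then
    A (dec n).1 (dec n).2 (al \o succn) else setT),
  (fun n al => if al 0%N == (dec n).1 then
    K (dec n).1 (dec n).2 (al \o succn) else setT),
  (fun n => (b (dec n).1 (dec n).2).+1); split.
- move=> n al; case: ifPn => _; last by split => //; exact: closedT.
  by have [+ _ _] := h (dec n).1; exact.
- move=> n al be ab; rewrite ab//; case: ifPn => //= _.
  have [_ + _] := h (dec n).1; apply => i ib; exact: ab.
- apply/seteqP; split => [p [m _]|p [al /= alP]].
    have [_ _ ->] := h m => -[al alP].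
    exists (fun i => if i is j.+1 then al j else m) => n /=.
    by case: ifPn => // /eqP <-; exact: alP.
  exists (al 0%N) => //; have [_ _ ->] := h (al 0%N).
  exists (al \o succn) => k; have := alP (choice.pickle (al 0%N, k)).
  by rewrite decK/= eqxx.
Qed.

(** One parameter carries a parameter for each [H m], whose [i]-th coordinate is stored at the code
    of [(m, i)]; a condition on finitely many coordinates remains one. *)
Lemma suslin_bigcap (H : nat -> set (T * X)) :
  (forall m, suslin (H m)) -> suslin (\bigcap_m H m).
Proof.
move=> /choice[A] /choice[K] /choice[b] h.
exists (fun n al => A (dec n).1 (dec n).2 (fun i => al (choice.pickle ((dec n).1, i)))),
  (fun n al => K (dec n).1 (dec n).2 (fun i => al (choice.pickle ((dec n).1, i)))),
  (fun n => (\max_(i < b (dec n).1 (dec n).2) (choice.pickle ((dec n).1, i : nat)).+1)%N).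
split.
- by move=> n al; have [+ _ _] := h (dec n).1; exact.
- move=> n al be ab; have [_ + _] := h (dec n).1; apply => i ib; apply: ab.
  exact: (leq_bigmax (Ordinal ib)).
- apply/seteqP; split => [p Hp|p [al /= alP] m _].
    have /choice[al alP] : forall m, exists al,
        forall k, A m k al p.1 /\ K m k al p.2.
      by move=> m; have := Hp m I; have [_ _ ->] := h m.
    exists (fun j => al (dec j).1 (dec j).2) => n /=.
    rewrite (_ : (fun i => _) = al (dec n).1) //.
    by apply/funext => i; rewrite decK.
  have [_ _ ->] := h m; exists (fun i => al (choice.pickle (m, i))) => k.
  by have := alP (choice.pickle (m, k)); rewrite decK.
Qed.

Lemma suslinI H1 H2 : suslin H1 -> suslin H2 -> suslin (H1 `&` H2).
Proof.
move=> s1 s2; rewrite -bigcap2E; apply: suslin_bigcap => -[|[|m]] //=.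
by rewrite -setXTT; apply: suslin_rect => //; exact: closedT.
Qed.

Lemma suslinU H1 H2 : suslin H1 -> suslin H2 -> suslin (H1 `|` H2).
Proof.
move=> s1 s2; rewrite -bigcup2E; apply: suslin_bigcup => -[|[|m]] //=.
by rewrite -(set0X [set: X]); apply: suslin_rect => //; exact: closedT.
Qed.

End suslin.

Section suslin_measurable.
Context (R : realType) d (T : measurableType d) (X : pmetricType R).

Lemma metric_ball_open (x : X) (e : R) : open (ball x e).
Proof.
rewrite openE => y; rewrite ballEmdist/= => xy; apply/nbhs_ballP.
exists (e - mdist x y) => /=; first by rewrite subr_gt0.
move=> z; rewrite !ballEmdist/= ltrBrDl; apply: le_lt_trans.
exact: metric_triangle.
Qed.

Lemma open_sigma_closed (V : set X) : open V ->
  exists F : nat -> set X, [/\ forall n, closed (F n),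
    {homo F : m n / (m <= n)%N >-> m `<=` n} & V = \bigcup_n F n].
Proof.
move=> oV; exists (fun n => [set x | ball x n.+1%:R^-1 `<=` V]); split.
- move=> n; rewrite -openC.
  rewrite (_ : ~` _ = \bigcup_(y in ~` V) ball y n.+1%:R^-1).
    by apply: bigcup_open => y _; exact: metric_ball_open.
  apply/seteqP; split => x /=.
    by move=> /existsNP[y /not_implyP[bxy Vy]]; exists y => //; exact: ball_sym.
  by move=> [y Vy yx] /(_ y) h; apply/Vy/h/ball_sym.
- move=> m n mn x; apply: subset_trans; apply: le_ball.
  by rewrite lef_pV2 ?posrE// ler_nat.
apply/seteqP; split => x; last first.
  by move=> [n _]; apply; exact: ballxx.
move=> Vx; have /nbhs_ballP[e /= e0 xeV] := open_nbhs_nbhs (conj oV Vx).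
have [N _ /(_ N (leqnn N)) Ne] := near_infty_natSinv_lt (PosNum e0).
by exists N => //= y xy; apply/xeV/(le_ball (ltW Ne)).
Qed.

(** The complement of a Souslin set need not be Souslin, so the induction runs over the sets that
    are Souslin together with their complement; these form a sigma-algebra. An open set belongs to
    it as a countable union of closed sets. *)
Lemma measurable_suslin (H : set (T * borel X)) : measurable H ->
  suslin (H : set (T * X)).
Proof.
pose D := [set H : set (T * X) | suslin H /\ suslin (~` H)].
have sD : sigma_algebra setT D.
  split.
  - split; first by rewrite -(set0X [set: X]); apply: suslin_rect => //; exact: closedT.
    by rewrite setC0 -setXTT; apply: suslin_rect => //; exact: closedT.
  - by move=> A [? ?]; rewrite setTD; split => //; rewrite setCK.
  - move=> F DF; split; first by apply: suslin_bigcup => n; have [] := DF n.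
    by rewrite setC_bigcup; apply: suslin_bigcap => n; have [] := DF n.
have DI A B : D A -> D B -> D (A `&` B).
  by move=> [? ?] [? ?]; split; [exact: suslinI|rewrite setCI; exact: suslinU].
have DA (A : set T) : measurable A -> D (A `*` setT).
  move=> mA; split; first by apply: suslin_rect => //; exact: closedT.
  rewrite (_ : ~` _ = (~` A) `*` setT).
    by apply: suslin_rect; [exact: measurableC|exact: closedT].
  by apply/seteqP; split => [p /not_andP[? //|/(_ I)] |p [nAp _] [/nAp]].
have DB (B : set (borel X)) : measurable B -> D (setT `*` B).
  move: B; apply: (@smallest_sub _ (sigma_algebra setT) _
    [set B : set X | D (setT `*` B)]).
    split => /=.
    - by rewrite setX0; have [] := sD.
    - move=> A DA'; have [_ /(_ _ DA') + _] := sD; rewrite !setTD; congr D.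
      by apply/seteqP; split => [p /not_andP[/(_ I)|? //]|p [_ nAp] [_ /nAp]].
    - move=> F DF; have [_ _ /(_ _ DF)] := sD; congr D.
      apply/seteqP; split => [p [n _ [_ Fp]]|p [_ [n _ Fp]]]; last by exists n.
      by split => //; exists n.
  move=> V oV; split.
    have [F [cF _ ->]] := open_sigma_closed oV.
    rewrite (_ : _ `*` _ = \bigcup_n (setT `*` F n)).
      by apply: suslin_bigcup => n; exact: suslin_rect.
    apply/seteqP; split => [p [_ [n _ Fp]]|p [n _ [_ Fp]]]; first by exists n.
    by split => //; exists n.
  rewrite (_ : ~` _ = setT `*` ~` V).
    by apply: suslin_rect => //; exact: open_closedC.
  by apply/seteqP; split => [p /not_andP[/(_ I)|? //]|p [_ nAp] [_ /nAp]].
move=> mH; suff : D H by case.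
move: H mH; rewrite measurable_prod_measurableType.
apply: smallest_sub => // _ [A mA [B mB <-]].
by rewrite -(setIT A) -(setTI B) setXI; apply: DI; [exact: DA|exact: DB].
Qed.

End suslin_measurable.

Section measurable_hull.
Context (R : realType) d (T : measurableType d) (P : probability T R).
Implicit Types S : set T.

(** For such a [B], [P B] is the outer measure of [S]. *)
Definition is_hull S B := [/\ measurable B, S `<=` B &
  forall C, measurable C -> S `<=` C -> (P B <= P C)%E].

Lemma hull_exists S : exists B, is_hull S B.
Proof.
pose V := P @` [set B | measurable B /\ S `<=` B].
have V0 : (0 <= ereal_inf V)%E by apply: le_ereal_inf_tmp => _ [B _ <-].
have V1 : (ereal_inf V <= 1)%E.
  rewrite -(probability_setT P); apply: ereal_inf_lbound.
  by exists setT => //; split => //; exact: measurableT.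
have Vfin : ereal_inf V \is a fin_num.
  by rewrite ge0_fin_numE// (le_lt_trans V1)// ltry.
have /choice[B BP] : forall n, exists B, [/\ measurable B, S `<=` B &
    (P B < ereal_inf V + (n.+1%:R^-1)%:E)%E].
  move=> n; have n0 : 0 < n.+1%:R^-1 :> R by rewrite invr_gt0.
  have [_ [B [mB SB] <-] PB] := lb_ereal_inf_adherent n0 Vfin.
  by exists B.
have mB n : measurable (B n) by case: (BP n).
exists (\bigcap_n B n); split.
- exact: bigcapT_measurable.
- by move=> x Sx n _; have [_ + _] := BP n; exact.
- move=> C mC SC; apply: (@le_trans _ _ (ereal_inf V)); last first.
    by apply: ereal_inf_lbound; exists C.
  apply/lee_addgt0Pr => e e0.
  have [N _ /(_ N (leqnn N)) Ne] := near_infty_natSinv_lt (PosNum e0).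
  apply: (@le_trans _ _ (P (B N))).
    apply: le_measure; rewrite ?inE//; first exact: bigcapT_measurable.
    by move=> x; apply.
  have [_ _ /ltW/le_trans] := BP N; apply.
  by rewrite leeD2l// lee_fin ltW.
Qed.

Definition hull S := projT1 (cid (hull_exists S)).
Lemma hullP S : is_hull S (hull S). Proof. exact: projT2 (cid _). Qed.

Lemma measurable_hull S : measurable (hull S). Proof. by case: (hullP S). Qed.

Lemma sub_hull S : S `<=` hull S. Proof. by case: (hullP S). Qed.

Lemma hull_min S C : measurable C -> S `<=` C -> (P (hull S) <= P C)%E.
Proof. by have [_ _] := hullP S; exact. Qed.

(** Outer measure is continuous along increasing sequences of arbitrary sets: the hulls need not
    increase, but the intersections [C n] of all later hulls do, and they still contain [S n]. *)
Lemma hull_bigcup_le (S : nat -> set T) (c : \bar R) :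
  {homo S : m n / (m <= n)%N >-> m `<=` n} ->
  (forall n, (P (hull (S n)) <= c)%E) -> (P (hull (\bigcup_n S n)) <= c)%E.
Proof.
move=> ndS Sc; pose C n := \bigcap_(m in [set m | (n <= m)%N]) hull (S m).
have mC n : measurable (C n).
  by apply: bigcap_measurable => [|k _]; [exists n => /=|exact: measurable_hull].
have mUC : measurable (\bigcup_n C n) by exact: bigcupT_measurable.
apply: (@le_trans _ _ (P (\bigcup_n C n))).
  apply: hull_min => // x [n _ Sx]; exists n => // m /= nm.
  exact/sub_hull/(ndS _ _ nm).
have ndC : {homo C : n m / (n <= m)%N >-> (n <= m)%O}.
  move=> n m nm; apply/subsetPset => x Cx k /= mk.
  by apply: Cx => /=; exact: leq_trans mk.
have cv := nondecreasing_cvg_mu (mu := P) mC mUC ndC.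
rewrite -(cvg_lim _ cv)//; apply: lime_le; first by apply/cvg_ex; eexists; exact: cv.
apply: nearW => n /=; apply: le_trans (Sc n).
apply: le_measure; rewrite ?inE//; first exact: measurable_hull.
by move=> x; apply => /=.
Qed.

(** A countable union of inner approximations fills the hull up to a null set; [S] lies in between,
    and completeness absorbs the difference. *)
Lemma inner_approx_measurable S : measure_is_complete P ->
  (forall e : R, 0 < e -> exists V, [/\ measurable V, V `<=` S &
     (P (hull S) - e%:E <= P V)%E]) -> measurable S.
Proof.
move=> Pc h.
have /choice[V VP] : forall n, exists V, [/\ measurable V, V `<=` S &
     (P (hull S) - (n.+1%:R^-1)%:E <= P V)%E].
  by move=> n; apply: h; rewrite invr_gt0.
pose W := \bigcup_n V n.
have mV n : measurable (V n) by case: (VP n).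
have mW : measurable W by exact: bigcupT_measurable.
have WS : W `<=` S by move=> x [n _]; have [_ + _] := VP n; exact.
have mD : measurable (hull S `\` W) by apply: measurableD => //; exact: measurable_hull.
have PD : P (hull S `\` W) = 0%E.
  apply/eqP; rewrite eq_le measure_ge0 andbT.
  rewrite measureD//; [|exact: measurable_hull|]; last first.
    by rewrite -ge0_fin_numE// fin_num_measure//; exact: measurable_hull.
  rewrite setIidr; last by apply: subset_trans WS _; exact: sub_hull.
  rewrite leeBlDr ?fin_num_measure// add0e; apply/lee_addgt0Pr => e e0.
  have [N _ /(_ N (leqnn N)) Ne] := near_infty_natSinv_lt (PosNum e0).
  have [_ _] := VP N; rewrite leeBlDr// => /le_trans; apply.
  apply: leeD; last by rewrite lee_fin ltW.
  by apply: le_measure; rewrite ?inE// => x Vx; exists N.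
rewrite (_ : S = W `|` (S `\` W)); last first.
  apply/seteqP; split => [x Sx|x [/WS//|[]//]].
  by have [|] := pselect (W x); [left|right].
apply: measurableU => //; apply: Pc; exists (hull S `\` W); split => //.
by move=> x [Sx Wx]; split => //; exact: sub_hull.
Qed.

End measurable_hull.

Section projection.
Context (R : realType) d (T : measurableType d) (P : probability T R)
  (X : pmetricType R).
Hypotheses (Pc : measure_is_complete P) (Xc : compact [set: X]).

(* Capacitability: the coordinates of the parameter are bounded one after the
   other while the outer measure stays above [c]. For parameters bounded by
   [be], compactness makes the projection the intersection of the sets [Q k],
   each of which only involves finitely many conditions. *)
Lemma suslin_projection (H : set (T * X)) : suslin H -> measurable (fst @` H).
Proof.
move=> [A [K [b [AK loc HE]]]]; apply: (inner_approx_measurable Pc) => e e0.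
set c := (P (hull P (fst @` H)) - e%:E)%E.
pose Hs (s : seq nat) := [set p : T * X | exists al,
  (forall i, (i < size s)%N -> (al i <= nth 0%N s i)%N) /\
  forall k, A k al p.1 /\ K k al p.2].
(* As [n] grows, the projections for [rcons s n] increase to the one for [s]; by [hull_bigcup_le]
   they cannot all have outer measure at most [c]. *)
have step s : exists n, (c < P (hull P (fst @` Hs s)))%E ->
    (c < P (hull P (fst @` Hs (rcons s n))))%E.
  have [cs|cs] := pselect (c < P (hull P (fst @` Hs s)))%E; last by exists 0%N.
  apply: contrapT => /forallNP hn.
  suff : (P (hull P (fst @` Hs s)) <= c)%E by rewrite leNgt cs.
  have := @hull_bigcup_le _ _ _ P (fun n => fst @` Hs (rcons s n)) c.
  have -> : \bigcup_n (fst @` Hs (rcons s n)) = fst @` Hs s.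
    apply/seteqP; split.
      move=> x [n _ [p [al [als alP]] <-]]; exists p => //; exists al; split => //.
      move=> i si; have := als i; rewrite size_rcons nth_rcons si; apply.
      exact: ltnW.
    move=> x [p [al [als alP]] <-]; exists (al (size s)) => //; exists p => //.
    exists al; split => // i; rewrite size_rcons ltnS leq_eqVlt nth_rcons.
    move=> /orP[/eqP->|si]; first by rewrite ltnn eqxx.
    by rewrite si; exact: als.
  apply.
    move=> m n mn x [p [al [als alP]] <-]; exists p => //; exists al; split => //.
    move=> i; have := als i; rewrite !size_rcons !nth_rcons => /[apply].
    by case: ifPn => // _; case: ifPn => // _ /leq_trans; apply.
  by move=> n; rewrite leNgt; apply/negP => cn; apply: (hn n).
have [f fP] := choice step.
pose fix s k := if k is j.+1 then rcons (s j) (f (s j)) else [::].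
have ss k : size (s k) = k by elim: k => //= k IH; rewrite size_rcons IH.
pose be i := f (s i).
have sbe k i : (i < k)%N -> nth 0%N (s k) i = be i.
  elim: k => // k IH; rewrite ltnS leq_eqVlt /= nth_rcons ss => /orP[/eqP->|ik].
    by rewrite ltnn eqxx.
  by rewrite ik IH.
have cs k : (c < P (hull P (fst @` Hs (s k))))%E.
  elim: k => [|k IH] /=; last exact: fP.
  have -> : Hs [::] = H.
    rewrite HE; apply/seteqP; split => p [al]; first by move=> [_ ?]; exists al.
    by move=> ?; exists al; split.
  rewrite /c lteBlDr// lteDl// ?fin_num_measure//; exact: measurable_hull.
pose Q k := [set w | exists al, (forall i, (al i <= be i)%N) /\
  exists x, forall j, (j <= k)%N -> A j al w /\ K j al x].
pose B k := (\max_(j < k.+1) b j)%N.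
have bB j k : (j <= k)%N -> (b j <= B k)%N.
  by move=> jk; exact: (leq_bigmax (Ordinal (jk : j < k.+1)%N)).
have mQ k : measurable (Q k).
  (* The conditions up to [k] only see the first [B k] coordinates, so finite sequences represent
     all parameters and the union is countable. [G s] collects what does not involve [w]. *)
  pose G (s : seq nat) := (forall i, (nth 0%N s i <= be i)%N) /\
    exists x, forall j, (j <= k)%N -> K j (nth 0%N s) x.
  rewrite (_ : Q k = \bigcup_s (if pselect (G s) then
      \bigcap_(j in [set j | (j <= k)%N]) A j (nth 0%N s) else set0)).
    apply: countable_bigcupT_measurable => // s'; case: pselect => //= Gs.
    by apply: bigcap_measurable => [|j _]; [exists 0%N|exact: (AK _ _).1].
  apply/seteqP; split => w.
    move=> [al [albe [x xP]]]; exists (mkseq al (B k)) => //.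
    have locB j : (j <= k)%N -> A j (nth 0%N (mkseq al (B k))) = A j al /\
        K j (nth 0%N (mkseq al (B k))) = K j al.
      move=> jk; apply: loc => i ib; rewrite nth_mkseq//.
      exact: leq_trans (bB _ _ jk).
    case: pselect => [_|nG] /=.
      by move=> j /= jk; rewrite (locB j jk).1; exact: (xP j jk).1.
    exfalso; apply: nG; split.
      move=> i; have [ik|ki] := ltnP i (B k); first by rewrite nth_mkseq.
      by rewrite nth_default// size_mkseq.
    by exists x => j jk; rewrite (locB j jk).2; exact: (xP j jk).2.
  move=> [s' _]; case: pselect => // -[sbe' [x xP]] /= wP.
  exists (nth 0%N s'); split => //; exists x => j jk; split; last exact: xP.
  exact: wP.
have cQ k : (c <= P (Q k))%E.
  apply: le_trans (ltW (cs (B k))) _; apply: hull_min => //.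
  move=> _ [p [al [alB alP]] <-].
  have locB j : (j <= k)%N -> A j (nth 0%N (mkseq al (B k))) = A j al /\
      K j (nth 0%N (mkseq al (B k))) = K j al.
    move=> jk; apply: loc => i ib; rewrite nth_mkseq//.
    exact: leq_trans (bB _ _ jk).
  exists (nth 0%N (mkseq al (B k))); split.
    move=> i; have [ik|ki] := ltnP i (B k).
      by rewrite nth_mkseq// -(sbe (B k))//; apply: alB; rewrite ss.
    by rewrite nth_default// size_mkseq.
  exists p.2 => j jk; rewrite (locB j jk).1 (locB j jk).2; exact: alP.
have mIQ : measurable (\bigcap_k Q k) by exact: bigcapT_measurable.
exists (\bigcap_k Q k); split => //; last first.
  have niQ : {homo Q : n m / (n <= m)%N >-> (m <= n)%O}.
    move=> n m nm; apply/subsetPset => w [al [albe [x xP]]].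
    exists al; split => //; exists x => j jn; apply: xP; exact: leq_trans nm.
  have fQ : (P (Q 0%N) < +oo)%E by rewrite -ge0_fin_numE// fin_num_measure.
  have cv := nonincreasing_cvg_mu (mu := P) fQ mQ mIQ niQ.
  rewrite -(cvg_lim _ cv)//; apply: lime_ge; first by apply/cvg_ex; eexists; exact: cv.
  exact: nearW.
(* Each [k] gives a parameter and a point satisfying the conditions up to [k]. Along an ultrafilter
   the points converge by compactness and every coordinate, being bounded by [be], is eventually
   constant; a condition involves finitely many coordinates and is closed in [x], so it survives. *)
move=> w wQ; have [U [UU ooU]] := ultra_above_oo.
have /choice[al alP] : forall k, exists al, (forall i, (al i <= be i)%N) /\
  exists x, forall j, (j <= k)%N -> A j al w /\ K j al x.
  by move=> k; exact: wQ.
have /choice[x xP] : forall k, exists x, forall j, (j <= k)%N ->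
  A j (al k) w /\ K j (al k) x.
  by move=> k; have [_] := alP k.
have [y _ xy] := ultra_compact_cvg (f := x) UU Xc filterT.
have /choice[v vP] : forall i, exists v, U [set k | al k i = v].
  move=> i; have [|v _ Uv] := @ultra_bounded_nat _ U (fun k => al k i) (be i) UU.
    by apply: filterS filterT => k _ /=; exact: (alP k).1.
  by exists v.
suff : H (w, y) by exists (w, y).
rewrite HE; exists v => j.
have Uj : U [set k | A j v w /\ K j v (x k)].
  have U1 : U [set k | forall i : 'I_(b j), al k i = v i].
    by apply: filter_forall => i; exact: vP.
  have U2 : U [set k | (j <= k)%N] by apply: ooU; exists j.
  apply: filterS2 U1 U2 => k /= alv jk.
  have [<- <-] := loc j (al k) v (fun i ib => alv (Ordinal ib)).
  exact: xP.
split => /=; first by have [k []] := filter_ex Uj.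
apply: (closed_cvg (K j v) (AK j v).2 _ _ xy).
by apply: filterS Uj => k [].
Qed.

Lemma measurable_projection (H : set (T * borel X)) :
  measurable H -> measurable (fst @` H).
Proof. by move=> /measurable_suslin; exact: suslin_projection. Qed.

End projection.

(** * Setwise convergence on Lebesgue spaces *)

Lemma uniform_approx_cvgn (R : realType) (a : nat -> R) :
  (forall e : R, 0 < e -> exists2 b : nat -> R, cvgn b & forall n, `|a n - b n| <= e) ->
  cvgn a.
Proof.
move=> h; apply/cauchy_cvgP/cauchy_exP => e e0.
have e20 : 0 < e / 2 by rewrite divr_gt0.
have [b /cvg_ex[l /cvgrPdist_lt/(_ _ e20)bl] ab] := h _ e20.
exists l; change (\forall n \near \oo, `|l - a n| < e).
near=> n.
have -> : l - a n = (l - b n) + (b n - a n) by rewrite addrA subrK.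
rewrite (le_lt_trans (ler_normD _ _))// [ltRHS]splitr ltr_leD//.
  by near: n.
by rewrite distrC.
Unshelve. all: by end_near. Qed.

Section dominated_additive.
Context (R : realType) d (T : measurableType d) (P : probability T R).

(** Meant for the functions sending [A] to the mass of [A] times a fixed cell, which lie below [P]
    because the marginal is [P]. *)
Definition dominated_additive (v : set T -> R) :=
  (forall A, measurable A -> 0 <= v A <= fine (P A)) /\
  forall A B, measurable A -> measurable B -> A `&` B = set0 ->
    v (A `|` B) = v A + v B.

Lemma dominated_additiveD v A B : dominated_additive v -> measurable A ->
  measurable B -> B `<=` A -> v (A `\` B) = v A - v B.
Proof.
move=> [_ vU] mA mB BA.
have -> : v A = v (B `|` (A `\` B)) by rewrite setDUK.
rewrite vU//; [by rewrite addrC addKr|exact: measurableD|by rewrite setDIK].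
Qed.

Variables (v : nat -> set T -> R) (vP : forall n, dominated_additive (v n)).

Let C := [set A | measurable A /\ cvgn (v ^~ A)].

Lemma dominated_cvgD A B : C A -> C B -> B `<=` A -> C (A `\` B).
Proof.
move=> [mA cA] [mB cB] BA; split; first exact: measurableD.
rewrite (_ : v ^~ _ = (v ^~ A) \- (v ^~ B)); first exact: is_cvgB.
by apply/funext => n /=; rewrite dominated_additiveD.
Qed.

(* The bound by [P] makes the tails of the union small uniformly in [n]. *)
Lemma dominated_cvg_bigcup (F : nat -> set T) : (forall k, C (F k)) ->
  trivIset setT F -> C (\bigcup_k F k).
Proof.
move=> CF tF; have mF k := (CF k).1.
have mU : measurable (\bigcup_k F k) by exact: bigcupT_measurable.
split=> //.
pose S k := \bigcup_(i in `I_k) F i.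
have SE k : S k = \big[setU/set0]_(i < k) F i by exact: bigcup_mkord.
have mS k : measurable (S k) by rewrite SE; exact: bigsetU_measurable.
have CS k : C (S k).
  elim: k => [|k [_ cS]]; first split => //.
    rewrite SE big_ord0 (_ : v ^~ _ = cst 0); first exact: is_cvg_cst.
    apply/funext => n; apply/eqP; rewrite eq_le andbC.
    by have := (vP n).1 _ measurable0; rewrite measure0.
  split => //; rewrite (_ : v ^~ _ = (v ^~ (S k)) \+ (v ^~ (F k))).
    by apply: is_cvgD => //; exact: (CF k).2.
  apply/funext => n /=; rewrite SE big_ord_recr/= -SE (vP n).2//.
  rewrite /S setI_bigcupl bigcup0// => i /= ik.
  by move/trivIsetP : tF; apply => //; rewrite neq_ltn ik.
apply: uniform_approx_cvgn => e e0.
pose D n := \bigcup_k F k `\` S n.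
have mD n : measurable (D n) by exact: measurableD.
have D0 : \bigcap_n D n = set0.
  apply/seteqP; split => // x /[dup] /(_ 0%N I)[[k _ Fk] _] /(_ k.+1 I)[_]; apply.
  by exists k => /=.
have niD : {homo D : n m / (n <= m)%N >-> (m <= n)%O}.
  move=> n m nm; apply/subsetPset => x [Ux nSx]; split => // -[i /= im Fx].
  by apply: nSx; exists i => //=; exact: leq_trans nm.
have fD n : P (D n) \is a fin_num by rewrite fin_num_measure.
have : fine (P (D n)) @[n --> \oo] --> 0.
  have mI : measurable (\bigcap_n D n) by rewrite D0.
  apply: fine_cvg; have fD0 : (P (D 0%N) < +oo)%E by rewrite -ge0_fin_numE.
  by have := nonincreasing_cvg_mu (mu := P) fD0 mD mI niD; rewrite D0 measure0.
move=> /cvgr_lt/(_ _ e0)[k _ /(_ k (leqnn k)) /= Pk].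
exists (v ^~ (S k)); first exact: (CS k).2.
move=> n.
have SU : S k `<=` \bigcup_k F k by move=> x [i _ Fx]; exists i.
have /andP[v0 v1] := (vP n).1 _ (mD k).
by rewrite -dominated_additiveD// ger0_norm// (le_trans v1)// ltW.
Qed.

Lemma dominated_null n A B : measurable A -> measurable B -> B `<=` A ->
  P (A `\` B) = 0%E -> v n A = v n B.
Proof.
move=> mA mB BA AB0; apply/eqP; rewrite -subr_eq0.
rewrite -(dominated_additiveD (vP n) mA mB BA) eq_le andbC.
by have := (vP n).1 _ (measurableD mA mB); rewrite AB0.
Qed.

End dominated_additive.

Lemma rat_rays_generate (R : realType) :
  @measurable _ (measurableTypeR R) =
  <<s [set A : set R | exists q : rat, A = `]ratr q, +oo[%classic] >>.
Proof.
apply/seteqP; split; last first.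
  apply: smallest_sub; first exact: sigma_algebra_measurable.
  by move=> _ [q ->]; exact: measurable_itv.
rewrite [X in X `<=` _]RGenOInfty.measurableE.
apply: smallest_sub; first exact: smallest_sigma_algebra.
move=> _ [x ->].
set G := [set A : set R | _].
have -> : `]x, +oo[%classic = \bigcup_(q : rat)
    (if x < ratr q then `](ratr q : R), +oo[%classic else set0).
  apply/seteqP; split => y /=; rewrite ?in_itv/= ?andbT.
    move=> /rat_in_itvoo[q]; rewrite in_itv/= => /andP[xq qy].
    by exists q => //=; rewrite xq /= in_itv/= qy.
  move=> [q _]; case: ifPn => // xq /=; rewrite in_itv/= andbT; exact: lt_trans.
apply: (@countable_bigcupT_measurable _ (g_sigma_algebraType G)) => [|q].
  exact: countableP.
by case: ifPn => // _; apply: sub_sigma_algebra; exists q.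
Qed.

(** The test sets are preimages of rational rays in the interval model. Dynkin's lemma extends
    convergence to preimages of Borel sets, and every measurable set agrees with one of these up to
    a [P]-null set, which dominated functions do not see. *)
Lemma lebesgue_space_setwise_cvg (R : realType) d (T : measurableType d)
    (P : probability T R) : lebesgue_space P ->
  exists2 G : nat -> set T, (forall k, measurable (G k)) &
    forall v : nat -> set T -> R, (forall n, dominated_additive P (v n)) ->
    (forall k, cvgn (v ^~ (G k))) -> forall A, measurable A -> cvgn (v ^~ A).
Proof.
move=> [_ [c [a [T0 [Y0 [phi [_ [mT0 PT0] [mY0 [fphi iphi sphi]] completed law]]]]]]].
have mpre (B : set (measurableTypeR R)) : measurable B ->
    measurable (T0 `&` phi @^-1` B).
  move=> mB; apply/completed; first exact: subIsetl.
  rewrite (_ : phi @` _ = Y0 `&` B); last first.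
    apply/seteqP; split => [_ [w [T0w Bw] <-]|y [Y0y By]].
      by split => //; exact: fphi.
    by have [w T0w wy] := sphi _ Y0y; exists w => //; split => //=; rewrite wy.
  exists (Y0 `&` B); first exact: measurableI.
  exists set0; last by rewrite setU0.
  exists set0; split => //; rewrite -law// preimage_set0 setI0 measure0//.
pose ray (q : rat) : set T := T0 `&` phi @^-1` `](ratr q : R), +oo[%classic.
(* Index 0, like every index coding no rational, holds the whole space: it stands for [T0], on which
   every [v n] has the same value. *)
exists (fun k => if k is j.+1 then
    if choice.unpickle j is Some q then ray q else setT else setT).
  move=> [|k] //; case: choice.unpickle => [q|] //; apply: mpre.
  exact: measurable_itv.
move=> v vP vG.
pose C A := measurable A /\ cvgn (v ^~ A).
have Cray q : C (ray q).
  split; first by apply: mpre; exact: measurable_itv.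
  by have := vG (choice.pickle q).+1; rewrite choice.pickleK.
have CT0 : C T0.
  split => //; rewrite (_ : v ^~ T0 = v ^~ setT); first exact: vG 0%N.
  apply/funext => n; apply/esym/(dominated_null vP) => //.
  by rewrite setTD probability_setC// PT0 subee.
have Cpre (B : set (measurableTypeR R)) : measurable B -> C (T0 `&` phi @^-1` B).
  rewrite [X in X B -> _]rat_rays_generate; move: B.
  apply: (@dynkin_induction _ (measurableTypeR R) _ _ (rat_rays_generate R)).
  - move=> _ _ [q ->] [r ->]; exists (Order.max q r).
    have [qr|rq] := leP q r; apply/seteqP; split => x /=; rewrite !in_itv/= !andbT.
    - by case.
    - by move=> rx; split => //; apply: le_lt_trans rx; rewrite ler_rat.
    - by case.
    - by move=> qx; split => //; apply: lt_trans qx; rewrite ltr_rat.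
  - by rewrite preimage_setT setIT.
  - by move=> _ [q ->]; exact: Cray.
  - move=> B mB CB; rewrite (_ : _ `&` _ = T0 `\` (T0 `&` phi @^-1` B)).
      by apply: dominated_cvgD CT0 CB _; [exact: vP|exact: subIsetl].
    by rewrite setDIr setDv set0U.
  - move=> F mF tF CF; rewrite preimage_bigcup setI_bigcupr.
    apply: (dominated_cvg_bigcup vP) => //; apply/trivIsetP => i j _ _ ij.
    rewrite setIACA -preimage_setI.
    by move/trivIsetP : tF => -> //; rewrite preimage_set0 setI0.
move=> A mA; have mA0 : measurable (A `&` T0) by exact: measurableI.
rewrite (_ : v ^~ A = v ^~ (A `&` T0)); last first.
  apply/funext => n; apply: (dominated_null vP) => //.
  apply/eqP; rewrite eq_le measure_ge0 andbT.
  have <- : P (~` T0) = 0%E by rewrite probability_setC// PT0 subee.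
  apply: le_measure; rewrite ?inE; [exact: measurableD|exact: measurableC|].
  by move=> w [Aw nAw] T0w; exact: nAw.
(* [B] fills the image of [A] up to a negligible set: by injectivity its preimage in [T0] lies in
   [A], and the rest of [A] is null. *)
have [B mB [N [N' [mN' N'0 NN']] BN]] := (completed _ (@subIsetr _ A T0)).1 mA0.
rewrite (_ : v ^~ _ = v ^~ (T0 `&` phi @^-1` B)); first exact: (Cpre _ mB).2.
apply/funext => n; apply: (dominated_null vP) => //; first exact: mpre.
  move=> w [T0w Bw].
  have [w' [Aw' T0w']] : (phi @` (A `&` T0)) (phi w) by rewrite -BN; left.
  by move=> /iphi ww'; rewrite -ww' ?inE.
apply/eqP; rewrite eq_le measure_ge0 andbT -N'0 -law//.
apply: le_measure; rewrite ?inE; [|exact: mpre|].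
  by apply: measurableD => //; exact: mpre.
move=> w [[Aw T0w] nBw]; split => //=.
have : (phi @` (A `&` T0)) (phi w) by exists w.
by rewrite -BN => -[Bw|/NN'//]; exfalso; exact: nBw.
Qed.

(** * Limits of measures with a fixed marginal *)

(** Since [M] does not depend on the points, all cells of depth [M] are small simultaneously. *)
Definition separating_sequence (R : realType) (X : pmetricType R)
    (U : nat -> set X) :=
  forall e : R, 0 < e -> exists M, forall x y,
    (forall i, (i < M)%N -> U i x <-> U i y) -> ball x e y.

(** For each [r] take a finite cover by balls of radius [1/(r+1)] and enumerate all these balls. Two
    points belonging to the same balls of one cover share a ball of it; [M] exceeds every code used
    by that cover. *)
Lemma compact_separating_sequence (R : realType) (X : pmetricType R) :
  compact [set: X] ->
  exists2 U : nat -> set X, (forall i, open (U i)) & separating_sequence U.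
Proof.
rewrite compact_cover => Xc.
have /choice[l lP] : forall r, exists l : seq X,
    forall x, exists2 k, (k < size l)%N & ball (nth point l k) (r.+1%:R^-1 : R) x.
  move=> r; have [] := Xc X setT (fun x => ball x (r.+1%:R^-1 : R)).
  - by move=> x _; exact: metric_ball_open.
  - by move=> x _; exists x => //; exact: ballxx.
  move=> F _ FX; exists (enum_fset F) => x.
  have [y yF yx] := FX x I; exists (index y F); first by rewrite index_mem.
  by rewrite nth_index.
pose dec n : nat * nat := odflt (0%N, 0%N) (choice.unpickle n).
pose U n := ball (nth point (l (dec n).1) (dec n).2) ((dec n).1.+1%:R^-1 : R).
exists U; first by move=> i; exact: metric_ball_open.
move=> e e0; have e20 : 0 < e / 2 by rewrite divr_gt0.
have [r _ /(_ r (leqnn r)) re] := near_infty_natSinv_lt (PosNum e20).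
exists (\max_(k < size (l r)) (choice.pickle (r, k : nat)).+1)%N => x y xy.
have [k kl kx] := lP r x.
have kM := leq_bigmax (F := fun k : 'I_(size (l r)) => (choice.pickle (r, k : nat)).+1)
  (Ordinal kl).
have := xy _ kM; rewrite /U /dec choice.pickleK/= => -[/(_ kx) ky _].
rewrite [e]splitr; apply: (@ball_triangle _ _ (nth point (l r) k)).
  by apply/ball_sym/(le_ball (ltW re)).
exact: (le_ball (ltW re)).
Qed.

(* An alias of the product, so that it carries the algebra of the sets
   [finite_dep] rather than the product sigma-algebra. *)
Definition cyl (T : Type) : Type := (T * (nat -> bool))%type.

Section cyl_algebra.
Context d (T : measurableType d).
Implicit Types (H : set (cyl T)) (c : nat -> bool).

Definition finite_dep H :=
  (exists m, forall w c c', (forall i, (i < m)%N -> c i = c' i) ->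
     H (w, c) -> H (w, c')) /\
  forall c, measurable [set w | H (w, c)].

Lemma finite_dep0 : finite_dep set0.
Proof. by split; [exists 0%N|move=> c; exact: measurable0]. Qed.

Lemma finite_depU : setU_closed finite_dep.
Proof.
move=> H1 H2 [[m1 dep1] mH1] [[m2 dep2] mH2]; split; last first.
  by move=> c; exact: measurableU (mH1 c) (mH2 c).
exists (maxn m1 m2) => w c c' cc' [H1c|H2c]; [left|right].
  by apply: dep1 H1c => i im; apply: cc'; rewrite leq_max im.
by apply: dep2 H2c => i im; apply: cc'; rewrite leq_max im orbT.
Qed.

Lemma finite_depC : setC_closed finite_dep.
Proof.
move=> H [[m dep] mH]; split; last by move=> c; exact: measurableC (mH c).
exists m => w c c' cc' nHc Hc'; apply: nHc; apply: dep Hc' => i im.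
by rewrite cc'.
Qed.

HB.instance Definition _ := Pointed.copy (cyl T) (T * (nat -> bool))%type.

HB.instance Definition _ := @isAlgebraOfSets.Build d (cyl T)
  finite_dep finite_dep0 finite_depU finite_depC.

Lemma cyl_section_seq H w c : measurable H -> H (w, c) ->
  exists s, H (w, nth false s).
Proof.
move=> [[m dep] mH] Hc; exists (mkseq c m); apply: dep Hc => i im.
by rewrite nth_mkseq.
Qed.

Lemma cyl_measurable_fst H : measurable H -> measurable (fst @` H).
Proof.
move=> mH; rewrite (_ : fst @` H = \bigcup_(s : seq bool) [set w | H (w, nth false s)]).
  by apply: countable_bigcupT_measurable => // s; exact: mH.2.
apply/seteqP; split => w; last by move=> [s _ Hs]; exists (w, nth false s).
by move=> [[w' c] /= /(cyl_section_seq mH)[s Hs] <-]; exists s.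
Qed.

(** Compactness of the space of codes: the codes [c n] have a bitwise limit [v] along an
    ultrafilter, and [H n] looks at finitely many bits, on which [v] agrees with some [c k],
    [k >= n]. *)
Lemma cyl_compact (H : nat -> set (cyl T)) : (forall n, measurable (H n)) ->
  {homo H : n m / (n <= m)%N >-> m `<=` n} ->
  \bigcap_n (fst @` H n) `<=` fst @` (\bigcap_n H n).
Proof.
move=> mH niH w wH; have [U [UU ooU]] := ultra_above_oo.
have /choice[c cH] : forall n, exists c, H n (w, c).
  by move=> n; have [[w' c] /= ? <-] := wH n I; exists c.
have /choice[v vP] : forall i, exists v, U [set n | c n i = v].
  move=> i; have [UT|UF] := in_ultra_setVsetC [set n | c n i] UU.
    by exists true.
  by exists false; apply: filterS UF => n /= /negP/negbTE.
exists (w, v) => // n _; have [[m dep] _] := mH n.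
have U1 : U [set k | forall i : 'I_m, c k i = v i].
  by apply: filter_forall => i; exact: vP.
have U2 : U [set k | (n <= k)%N] by apply: ooU; exists n.
have [k [/= cv nk]] := filter_ex (filterI U1 U2).
apply: (dep w (c k)); first by move=> i im; exact: (cv (Ordinal im)).
exact: (niH _ _ nk).
Qed.

End cyl_algebra.

Definition code (X : Type) (U : nat -> set X) (x : X) (i : nat) : bool :=
  `[< U i x >].

Definition prefix_cell (X : Type) (U : nat -> set X) (c : nat -> bool) (m : nat) :=
  [set x | forall i, (i < m)%N -> code U x i = c i].

Section limit_on_cylinders.
Context (R : realType) d (T : measurableType d) (P : probability T R)
  (X : pmetricType R) (U : nat -> set X).
Hypothesis Uopen : forall i, open (U i).
Local Notation TX := (T * borel X)%type.
Variable mu_ : nat -> {measure set TX -> \bar R}.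
Hypothesis mu_marginal :
  forall n A, measurable A -> mu_ n (fst @^-1` A) = P A.
Hypothesis mu_cvg : forall A c m, measurable A ->
  cvgn (fun n => fine (mu_ n (A `*` prefix_cell U c m))).

Lemma measurable_prefix_cell c m : measurable (prefix_cell U c m : set (borel X)).
Proof.
have mU i : measurable (U i : set (borel X)) by exact: sub_sigma_algebra.
rewrite (_ : prefix_cell U c m =
    \bigcap_(i in `I_m) (if c i then U i else ~` U i)).
  apply: fin_bigcap_measurable => // i _.
  by case: (c i) => //; exact: measurableC.
apply/seteqP; split => x h i im.
  have := h i im; rewrite /code; case: (c i) => [/asboolP//|].
  by move/negbT/asboolPn.
have := h i im; rewrite /code; case: (c i) => [/asboolT//|].
by move/asboolPn/negbTE.
Qed.

Definition pull (H : set (cyl T)) : set TX := [set p | H (p.1, code U p.2)].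

Lemma pull_split H c m : pull H `&` (setT `*` prefix_cell U c m) =
  (pull H `&` (setT `*` prefix_cell U (fun i => if (i == m) then true else c i) m.+1)) `|`
  (pull H `&` (setT `*` prefix_cell U (fun i => if (i == m) then false else c i) m.+1)).
Proof.
rewrite -setIUr; congr (_ `&` _); apply/seteqP; split => p.
  move=> [_ cp]; case E : (code U p.2 m); [left|right]; split => //= i.
    rewrite ltnS leq_eqVlt => /orP[/eqP ->|im]; first by rewrite eqxx.
    by rewrite ltn_eqF//; exact: cp.
  rewrite ltnS leq_eqVlt => /orP[/eqP ->|im]; first by rewrite eqxx.
  by rewrite ltn_eqF//; exact: cp.
by move=> [|] [_ cp]; split => // i im;
  rewrite (cp i (ltnW _)) ?ltnS// ltn_eqF.
Qed.

Lemma mu_fin n B : measurable B -> mu_ n B \is a fin_num.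
Proof.
move=> mB; apply: lty_fin_num_fun => //.
by rewrite -(preimage_setT (@fst T (borel X))) mu_marginal// probability_setT ltry.
Qed.

(** At depth [m] every piece is a product of a measurable set and a cell, covered by [mu_cvg]. The
    induction goes back up to depth 0, gluing two disjoint halves along one bit each time. *)
Lemma pull_measurable_cvg H : finite_dep H ->
  measurable (pull H) /\ cvgn (fun n => fine (mu_ n (pull H))).
Proof.
move=> [[m dep] mH].
pose good B := measurable B /\ cvgn (fun n => fine (mu_ n B)).
have goodU A B : good A -> good B -> A `&` B = set0 -> good (A `|` B).
  move=> [mA cA] [mB cB] AB; split; first exact: measurableU.
  rewrite (_ : (fun n => _) = (fun n => fine (mu_ n A)) \+ (fun n => fine (mu_ n B))).
    exact: is_cvgD.
  by apply/funext => n /=; rewrite measureU// fineD// mu_fin.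
suff h k : (k <= m)%N -> forall c, good (pull H `&` (setT `*` prefix_cell U c (m - k))).
  have := h m (leqnn m) (fun=> false); rewrite subnn.
  by rewrite (_ : prefix_cell _ _ _ = setT) ?setXTT ?setIT// -subTset.
elim: k => [_ c|k IH km c].
  rewrite subn0 (_ : _ `&` _ = [set w | H (w, c)] `*` prefix_cell U c m).
    split; last by apply: mu_cvg; exact: mH.
    by apply: measurableX => //; exact: measurable_prefix_cell.
  apply/seteqP; split => [[w x] [/= Hw [_ cx]]|[w x] [/= Hw cx]].
    by split => //; apply: dep Hw.
  by split => //; apply: dep Hw => i im; rewrite cx.
rewrite pull_split -subSn// subSS; apply: goodU; [exact: IH (ltnW km) _|exact: IH (ltnW km) _|].
apply/seteqP; split => // p [[_ [_ c1]] [_ [_ c2]]].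
have lt : (m - k.+1 < m - k)%N by rewrite ltn_sub2l.
by have := c1 _ lt; rewrite (c2 _ lt) eqxx.
Qed.

Definition cyl_lim (H : set (cyl T)) : \bar R :=
  (limn (fun n => fine (mu_ n (pull H))))%:E.

Lemma cyl_lim_cvg H : finite_dep H -> mu_ n (pull H) @[n --> \oo] --> cyl_lim H.
Proof.
move=> dH; have [mp cp] := pull_measurable_cvg dH.
apply: cvg_EFin => //; apply: nearW => n; exact: mu_fin.
Qed.

Lemma cyl_lim_ge0 H : (0 <= cyl_lim H)%E.
Proof.
rewrite lee_fin; have [c|c] := pselect (cvgn (fun n => fine (mu_ n (pull H)))).
  by apply: limr_ge => //; apply: nearW => n; rewrite fine_ge0.
(* The limit of a divergent sequence is the default value 0. *)
by rewrite dvgP//.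
Qed.

Lemma cyl_lim0 : cyl_lim set0 = 0%E.
Proof.
have h := cyl_lim_cvg (finite_dep0 T); apply: (cvg_unique _ h) => //.
rewrite (_ : (fun n => _) = cst 0%E); first exact: cvg_cst.
by apply/funext => n; exact: measure0.
Qed.

Lemma cyl_lim_additive : @measure_function.semi_additive _ R (cyl T) cyl_lim.
Proof.
apply/(additive2P cyl_lim0) => A B mA mB AB.
have cA := cyl_lim_cvg mA; have cB := cyl_lim_cvg mB.
have cAB := cyl_lim_cvg (finite_depU mA mB).
have [pA _] := pull_measurable_cvg mA; have [pB _] := pull_measurable_cvg mB.
apply: (cvg_unique _ cAB) => //.
rewrite (_ : (fun n => _) = (fun n => mu_ n (pull A) + mu_ n (pull B))%E).
  by apply: cvgeD => //.
apply/funext => n; rewrite -measureU//.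
apply/seteqP; split => // p [Ap Bp].
by have : (A `&` B) (p.1, code U p.2) by []; rewrite AB.
Qed.

(** The fixed marginal enters here: it bounds the limit, so far only finitely additive, by a measure
    that is continuous along decreasing sequences. *)
Lemma cyl_lim_le_fst H : finite_dep H -> (cyl_lim H <= P (fst @` H))%E.
Proof.
move=> dH; have c := cyl_lim_cvg dH; rewrite -(cvg_lim _ c)//.
have mf := cyl_measurable_fst dH; have [mp _] := pull_measurable_cvg dH.
apply: lime_le; first by apply/cvg_ex; eexists; exact: c.
apply: nearW => n; rewrite -(mu_marginal n mf); apply: le_measure; rewrite ?inE//.
  by rewrite -[X in measurable X]setTI; exact: measurable_fst.
by move=> p Hp; exists (p.1, code U p.2).
Qed.

(* By [cyl_compact], cylinders decreasing to the empty set have projections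
   decreasing to the empty set, whose [P]-measure tends to 0. *)
Lemma cyl_lim_sigma_subadditive (lam : {content set (cyl T) -> \bar R}) :
  (lam : set (cyl T) -> \bar R) = cyl_lim ->
  measurable_subset_sigma_subadditive lam.
Proof.
move=> lamE A F mF mA AF; pose B n := A `\` \big[setU/set0]_(k < n) F k.
have mU n : measurable (\big[setU/set0]_(k < n) F k) by exact: bigsetU_measurable.
have mB n : measurable (B n) by exact: measurableD.
have mfB n : measurable (fst @` B n : set T) by exact: cyl_measurable_fst.
have niB : {homo B : n m / (n <= m)%N >-> m `<=` n}.
  move=> n m nm p [Ap nUp]; split => //; rewrite -bigcup_mkord => -[i /= im Fp].
  by apply: nUp; rewrite -bigcup_mkord; exists i => //=; exact: leq_trans nm.
have B0 : \bigcap_n B n = set0.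
  apply/seteqP; split => // p Bp; have [k _ Fk] := AF _ (Bp 0%N I).1.
  by have [_] := Bp k.+1 I; apply; rewrite -bigcup_mkord; exists k => /=.
have fB0 : \bigcap_n (fst @` B n) = set0.
  apply/seteqP; split => //; apply: subset_trans (cyl_compact mB niB) _.
  by rewrite B0 image_set0.
have PB : P (fst @` B n) @[n --> \oo] --> 0%E.
  rewrite -(measure0 P) -fB0; apply: (nonincreasing_cvg_mu (mu := P)) => //.
  - by rewrite -ge0_fin_numE// fin_num_measure.
  - by rewrite fB0.
  - by move=> n m nm; apply/subsetPset/image_subset/niB.
have le n : (lam A <= \sum_(0 <= k < n) lam (F k) + P (fst @` B n))%E.
  apply: (@le_trans _ _ (\sum_(k < n.+1) lam (if (k < n)%N then F k else B n))%E).
    apply: (@content_subadditive _ _ _ lam A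
      (fun k => if (k < n)%N then F k else B n)) => //.
      by move=> k _ /=; case: ifP.
    rewrite big_ord_recr/= ltnn; under eq_bigr do rewrite ltn_ord.
    move=> p Ap; have [|] := pselect ((\big[setU/set0]_(k < n) F k) p); first by left.
    by right.
  rewrite big_ord_recr/= ltnn; under eq_bigr do rewrite ltn_ord.
  by rewrite big_mkord leeD2l// lamE; exact: cyl_lim_le_fst (mB n).
have cs : (\sum_(0 <= k < n) lam (F k))%E @[n --> \oo] --> (\sum_(k <oo) lam (F k))%E.
  by apply: is_cvg_nneseries => k _ _; exact: measure_ge0.
rewrite -[leRHS]adde0.
have cv : ((\sum_(0 <= k < n) lam (F k)) + P (fst @` B n))%E @[n --> \oo] -->
    (\sum_(k <oo) lam (F k) + 0)%E by apply: cvgeD => //; rewrite fin_num_adde_defl.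
rewrite -(cvg_lim _ cv)//; apply: lime_ge; first by apply/cvg_ex; eexists; exact: cv.
exact: nearW.
Qed.

(** Carathéodory extension from the algebra of cylinders to the sigma-algebra it generates. *)
Lemma cyl_limit_measure :
  exists lam : {measure set (g_sigma_algebraType (@measurable d (cyl T))) -> \bar R},
    forall H, finite_dep H -> mu_ n (pull H) @[n --> \oo] --> lam H.
Proof.
pose lamC : {content set (cyl T) -> \bar R} :=
  HB.pack cyl_lim (isContent.Build _ _ _ cyl_lim cyl_lim_ge0 cyl_lim_additive).
have sadd : semi_sigma_additive (cyl_lim : set (cyl T) -> \bar R).
  exact: content_ring_sigma_additive (@cyl_lim_sigma_subadditive lamC erefl).
pose lamM : {measure set (cyl T) -> \bar R} :=
  HB.pack cyl_lim (isMeasure.Build _ _ _ cyl_lim cyl_lim0 cyl_lim_ge0 sadd).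
exists (measure_extension lamM) => H dH.
have E : ((lamM : set (cyl T) -> \bar R)^*)%mu H = cyl_lim H.
  exact: measurable_mu_extE.
by have := cyl_lim_cvg dH; rewrite -E.
Qed.

End limit_on_cylinders.

(** * Lower limits and Fatou's lemma for setwise convergence *)

Section limn_einf_extra.
Context (R : realType).
Local Open Scope ereal_scope.
Implicit Types u v : nat -> \bar R.

Lemma ge_limn_einf u l : (\forall n \near \oo, l <= u n) -> l <= limn_einf u.
Proof.
move=> [N _ Nu]; rewrite limn_einf_lim; apply: lime_ge; first exact: is_cvg_einfs.
exists N => // n /= Nn; apply: le_ereal_inf_tmp => _ [k /= nk <-].
exact/Nu/(leq_trans Nn).
Qed.

Lemma le_limn_einf u v : (forall n, u n <= v n) -> limn_einf u <= limn_einf v.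
Proof.
move=> uv; rewrite !limn_einf_lim; apply: lee_lim; [exact: is_cvg_einfs..|].
apply: nearW => n; apply: le_ereal_inf_tmp => _ [k /= nk <-].
by apply: le_trans (uv k); apply: ereal_inf_lbound; exists k.
Qed.

Lemma lee_real_lt (x y : \bar R) :
  (forall a : R, a%:E < x -> a%:E <= y) -> x <= y.
Proof.
move=> h; rewrite leNgt; apply/negP => yx.
have [r yr rx] : exists2 r : R, y < r%:E & r%:E < x.
  case: y x yx {h} => [y| |] [x| |] //.
  - rewrite lte_fin => /midf_lt[]; exists ((y + x) / 2)%R; rewrite lte_fin //.
  - by move=> _; exists (y + 1)%R; rewrite ?lte_fin ?ltrDl// ltry.
  - by move=> _; exists (x - 1)%R; rewrite ?ltNyr// lte_fin ltrBlDr ltrDl.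
  - by move=> _; exists 0%R; rewrite ?ltNyr ?ltry.
by have := h r rx; rewrite leNgt yr.
Qed.

End limn_einf_extra.

Section setwise_fatou.
Import HBNNSimple.

(** A simple function below [f] has finitely many level sets, so its integrals converge; the
    supremum over such functions gives the inequality. *)
Lemma setwise_cvg_fatou (R : realType) d (T : measurableType d)
    (mu_ : nat -> {measure set T -> \bar R}) (mu : {measure set T -> \bar R})
    (f : T -> \bar R) :
  (forall A, measurable A -> mu_ n A @[n --> \oo] --> mu A) ->
  (forall x, 0 <= f x)%E ->
  (\int[mu]_x f x <= limn_einf (fun n => \int[mu_ n]_x f x))%E.
Proof.
move=> cmu f0; rewrite ge0_integralTE//; apply: ge_ereal_sup => _ [h /= hf <-].
have ch : sintegral (mu_ n) h @[n --> \oo] --> sintegral mu h.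
  rewrite sintegralE fsbig_finite//=.
  rewrite (_ : (fun n => _) = (fun n => \sum_(r <- fset_set (range h))
      r%:E * mu_ n (h @^-1` [set r]))%E); last first.
    by apply/funext => n; rewrite sintegralE fsbig_finite.
  apply: cvg_nnesum => [r _|r _].
    by apply: nearW => n; apply: (mulemu_ge0 (fun x => h @^-1` [set x])) => r0; rewrite preimage_nnfun0.
  by apply: cvgeZl => //; exact: cmu.
rewrite -(cvg_limn_einf_sup ch).1; apply: le_limn_einf => n.
by rewrite ge0_integralTE//; apply: ereal_sup_ubound; exists h.
Qed.

End setwise_fatou.

Lemma codeP (X : Type) (U : nat -> set X) x i : U i x <-> code U x i.
Proof. by split=> /asboolP. Qed.

(** * Decoding a limit of codes, and lower semicontinuous integrands *)

Section limit_point.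
Context (R : realType) (X : pmetricType R) (U : nat -> set X).
Hypotheses (Xc : compact [set: X]) (Usep : separating_sequence U).
Implicit Types (c : nat -> bool) (m : nat).

(* If some cell of [c] is empty, this is eventually the default [point]. *)
Definition cell_point c m := xget point (prefix_cell U c m).

(** Points of a common deep cell are within [e / 2] of each other, so a limit along an ultrafilter
    is a limit of the whole sequence. *)
Lemma cell_point_cvg c : exists x : X, cell_point c m @[m --> \oo] --> x.
Proof.
have [g|] := pselect (forall m, prefix_cell U c m !=set0); last first.
  move=> /existsNP[m0 g]; exists point; apply: cvg_near_cst.
  exists m0 => // m /= m0m; rewrite /cell_point; case: xgetP => // x _ cx.
  by exfalso; apply: g; exists x => i im; apply: cx; exact: leq_trans m0m.
have cp m : prefix_cell U c m (cell_point c m).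
  by have [x cx] := g m; apply: (@xgetI _ point _ x).
have [UF [UU ooU]] := ultra_above_oo.
have [x _ xc] := ultra_compact_cvg (f := cell_point c) UU Xc filterT.
exists x; apply/cvg_ballP => e e0.
have e20 : 0 < e / 2 by rewrite divr_gt0.
have [M MU] := Usep e20.
exists M => // m /= Mm.
have U1 : UF [set m | ball x (e / 2) (cell_point c m)] by move/cvg_ballP : xc; exact.
have U2 : UF [set m | (M <= m)%N] by apply: ooU; exists M.
have [k [/= xk Mk]] := filter_ex (filterI U1 U2).
rewrite [e]splitr; apply: ball_triangle xk _; apply: MU => i iM.
have E : code U (cell_point c k) i = code U (cell_point c m) i.
  by rewrite (cp k i (leq_trans iM Mk)) (cp m i (leq_trans iM Mm)).
by split => h; apply/codeP; [rewrite -E|rewrite E]; exact/codeP.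
Qed.

(** A left inverse of [code U], extended to the codes that come from no point of [X]; a limit of
    measures may charge these. *)
Definition limit_point c := projT1 (cid (cell_point_cvg c)).

Lemma limit_pointP c : cell_point c m @[m --> \oo] --> limit_point c.
Proof. by rewrite /limit_point; case: cid. Qed.

End limit_point.

(** The measures live on different spaces, points on one side and codes on the other; their images
    in [Z] converge setwise. *)
Lemma setwise_cvg_fatou_comp (R : realType) dY (Y : measurableType dY)
    dY' (Y' : measurableType dY') dZ (Z : measurableType dZ)
    (g : Y -> Z) (g' : Y' -> Z) (h : Z -> \bar R)
    (mu_ : nat -> {measure set Y' -> \bar R}) (mu : {measure set Y -> \bar R}) :
  measurable_fun setT g -> measurable_fun setT g' -> measurable_fun setT h ->
  (forall z, 0 <= h z)%E ->
  (forall B, measurable B -> mu_ n (g' @^-1` B) @[n --> \oo] --> mu (g @^-1` B)) ->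
  (\int[mu]_y h (g y) <= limn_einf (fun n => \int[mu_ n]_y h (g' y)))%E.
Proof.
move=> mg mg' mh h0 cmu.
have mE : (\int[pushforward mu g]_z h z = \int[mu]_y h (g y))%E.
  by rewrite (ge0_integral_pushforward mg).
have mnE n : (\int[pushforward (mu_ n) g']_z h z = \int[mu_ n]_y h (g' y))%E.
  by rewrite (ge0_integral_pushforward mg').
rewrite -mE; under [X in limn_einf X]eq_fun do rewrite -mnE.
exact: (@setwise_cvg_fatou _ _ _ (fun n => pushforward (mu_ n) g')).
Unshelve. all: by [].
Qed.

Lemma pushforward_measure (R : realType) d d' (T : measurableType d)
    (T' : measurableType d') (m : {measure set T -> \bar R}) (f : T -> T') :
  measurable_fun setT f ->
  exists m' : {measure set T' -> \bar R}, m' = pushforward m f :> (set T' -> \bar R).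
Proof.
move=> mf; eexists (pushforward m f : {measure set T' -> \bar R}); reflexivity.
Unshelve. exact: mf. Qed.

Section probability_of_measure.
Context (R : realType) d (T : measurableType d) (m : {measure set T -> \bar R}).
Hypothesis m1 : m setT = 1%E.

Definition measure_as_probability : set T -> \bar R := m.

HB.instance Definition _ := Measure.copy measure_as_probability m.
HB.instance Definition _ :=
  Measure_isProbability.Build _ _ _ measure_as_probability m1.

Lemma measure_probability : exists p : probability T R, p = m :> (set T -> \bar R).
Proof. by exists measure_as_probability. Qed.

End probability_of_measure.

Section lower_semicontinuity.
Context (R : realType) d (T : measurableType d) (P : probability T R)
  (X : pmetricType R) (U : nat -> set X).
Hypotheses (Pc : measure_is_complete P) (Xc : compact [set: X])
  (Uopen : forall i, open (U i)) (Usep : separating_sequence U).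
Local Notation TX := (T * borel X)%type.
Variable mu_ : nat -> {measure set TX -> \bar R}.
Hypothesis mu_marginal :
  forall n A, measurable A -> mu_ n (fst @^-1` A) = P A.
Hypothesis mu_cvg : forall A c m, measurable A ->
  cvgn (fun n => fine (mu_ n (A `*` prefix_cell U c m))).
Local Notation CT := (g_sigma_algebraType (@measurable d (cyl T))).
Let xi := limit_point Xc Usep.

Lemma measurable_cyl (H : set CT) : finite_dep H -> measurable H.
Proof. exact: sub_sigma_algebra. Qed.

Lemma prefix_cell_ext c c' m : (forall i, (i < m)%N -> c i = c' i) ->
  prefix_cell U c m = prefix_cell U c' m.
Proof. by move=> cc; apply/seteqP; split => x cx i im; rewrite cx// cc. Qed.

Lemma finite_dep_bits (Q : (nat -> bool) -> Prop) m :
  (forall c c', (forall i, (i < m)%N -> c i = c' i) -> Q c -> Q c') ->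
  finite_dep [set p : cyl T | Q p.2].
Proof.
move=> Qm; split; first by exists m => w c c' /Qm; exact.
move=> c; have [q|q] := pselect (Q c).
  by rewrite (_ : [set w | _] = setT)// -subTset => w _.
by rewrite (_ : [set w | _] = set0)// -subset0 => w.
Qed.

Lemma measurable_cyl_fst : measurable_fun setT (fst : CT -> T).
Proof.
move=> _ A mA; rewrite setTI; apply: measurable_cyl; split; first by exists 0%N.
by move=> c; exact: mA.
Qed.

(** The limit lies in an open [V] exactly when, for some [r], the balls of radius [1/(r+1)] about
    all but finitely many cell points lie in [V]. For a given depth this is a condition on finitely
    many bits. *)
Lemma measurable_limit_point :
  measurable_fun setT (fun p : CT => xi p.2 : borel X).
Proof.
apply: (@measurability _ _ CT (borel X) setT (fun p : CT => xi p.2) (@open X)) => //.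
move=> _ [V oV <-]; rewrite setTI.
pose B r m := [set p : CT | ball (cell_point U p.2 m) (r.+1%:R^-1 : R) `<=` V].
have mB r m : measurable (B r m).
  apply: measurable_cyl.
  apply: (@finite_dep_bits (fun c => ball (cell_point U c m) (r.+1%:R^-1 : R) `<=` V) m).
  by move=> c c' cc'; rewrite /cell_point (prefix_cell_ext cc').
rewrite (_ : _ @^-1` _ =
    \bigcup_r \bigcup_m0 \bigcap_(m in [set m | (m0 <= m)%N]) B r m).
  apply: bigcupT_measurable => r; apply: bigcupT_measurable => m0.
  by apply: bigcap_measurable => [|m _]; [exists m0 => /=|exact: mB].
apply/seteqP; split => [[w c]|[w c] [r _ [m0 _ rm]]] /=.
  move=> Vxi; have /nbhs_ballP[e /= e0 eV] := open_nbhs_nbhs (conj oV Vxi).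
  have e20 : 0 < e / 2 by rewrite divr_gt0.
  have [r _ /(_ r (leqnn r)) re] := near_infty_natSinv_lt (PosNum e20).
  have /cvg_ballP/(_ _ e20)[m0 _ cm] := @limit_pointP _ _ _ Xc Usep c.
  exists r => //; exists m0 => // m /= m0m y; rewrite /= => ym.
  apply: eV; rewrite [e]splitr; apply: ball_triangle (cm _ m0m) _.
  exact: (le_ball (ltW re)).
have r0 : 0 < r.+1%:R^-1 :> R by rewrite invr_gt0.
have /cvg_ballP/(_ _ r0)[m1 _ cm] := @limit_pointP _ _ _ Xc Usep c.
apply: (rm (maxn m0 m1) (leq_maxl _ _)); apply/ball_sym; apply: cm => /=.
exact: leq_maxr.
Qed.

Lemma measurable_limit_map :
  measurable_fun setT (fun p : CT => (p.1, xi p.2) : TX).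
Proof.
by apply: measurable_fun_pair; [exact: measurable_cyl_fst|exact: measurable_limit_point].
Qed.

(* The first [m] bits are packed into an integer, so that functions of them are
   defined on a product of measurable spaces. *)
Definition truncate m (p : cyl T) : T * nat :=
  (p.1, choice.pickle (mkseq p.2 m)).

Lemma finite_dep_truncate m B : measurable B -> finite_dep (truncate m @^-1` B).
Proof.
move=> mB; split.
  exists m => w c c' cc'; rewrite /truncate /=.
  suff -> : mkseq c m = mkseq c' m by [].
  by apply/eq_in_map => i; rewrite mem_iota/= add0n => /cc'.
move=> c; have := measurable_ysection (choice.pickle (mkseq c m)) mB.
by congr measurable; apply/seteqP; split => w; rewrite /ysection/= inE.
Qed.

Lemma measurable_truncate m : measurable_fun setT (truncate m : CT -> T * nat).
Proof.
move=> _ B mB; rewrite setTI; apply: measurable_cyl; exact: finite_dep_truncate.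
Qed.

Lemma measurable_truncate_code m :
  measurable_fun setT (fun p : TX => truncate m (p.1, code U p.2)).
Proof.
move=> _ B mB; rewrite setTI.
have := (pull_measurable_cvg Uopen mu_marginal mu_cvg (finite_dep_truncate m mB)).1.
exact.
Qed.

Section integrand.
Variable f : TX -> \bar R.
Hypotheses (mf : measurable_fun setT f) (f0 : forall p, (0 <= f p)%E).

Definition cell_inf m (q : T * nat) : \bar R :=
  ereal_inf [set f (q.1, x) | x in
    prefix_cell U (nth false (odflt [::] (choice.unpickle q.2))) m].

Lemma measurable_cell_inf m : measurable_fun setT (cell_inf m).
Proof.
apply: (measurability _ (ErealGenInftyO.measurableE R)) => _ [_ [r ->] <-].
rewrite setTI.
pose V k := fst @` ([set p | f p < r%:E]%E `&`
  (setT `*` prefix_cell U (nth false (odflt [::] (choice.unpickle k))) m)).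
rewrite (_ : _ @^-1` _ = \bigcup_k (V k `*` [set k])).
  apply: bigcupT_measurable => k; apply: measurableX => //.
  apply: (measurable_projection Pc Xc); apply: measurableI.
    by rewrite -[X in measurable X]setTI; exact: emeasurable_fun_infty_o.
  apply: measurableX => //; exact: measurable_prefix_cell.
apply/seteqP; split => [[w k]|[w k] [k' _ [[[w' x] [/= fr [_ cx]] <-] /= ->]]] /=;
    rewrite in_itv /=.
  move=> /ereal_inf_ltP[_ [x cx <-] fr]; exists k => //; split => //.
  by exists (w, x).
by apply/ereal_inf_ltP; exists (f (w', x)) => //; exists x.
Qed.

Lemma cell_inf_ge0 m q : (0 <= cell_inf m q)%E.
Proof. by apply: le_ereal_inf_tmp => _ [x _ <-]. Qed.

Lemma cell_inf_truncate m p : cell_inf m (truncate m p) =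
  ereal_inf [set f (p.1, x) | x in prefix_cell U p.2 m].
Proof.
have -> : cell_inf m (truncate m p) = ereal_inf
    [set f (p.1, x) | x in prefix_cell U (nth false (mkseq p.2 m)) m].
  by rewrite /cell_inf (choice.pickleK (mkseq p.2 m)).
congr (ereal_inf (_ @` _)).
by apply: prefix_cell_ext => i im; rewrite nth_mkseq.
Qed.

Lemma cell_inf_le m p : (cell_inf m (truncate m (p.1, code U p.2)) <= f p)%E.
Proof.
rewrite cell_inf_truncate; apply: ereal_inf_lbound; exists p.2 => //.
by case: p.
Qed.

(** Nonempty deep cells of [c] shrink to [xi c], whether or not they contain it, so lower
    semicontinuity there bounds [f] from below on them; over an empty cell the infimum is +oo. *)
Lemma cell_inf_liminf w c : lower_semicontinuous (fun x : X => f (w, x)) ->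
  (f (w, xi c) <= limn_einf (fun m => cell_inf m (truncate m (w, c))))%E.
Proof.
move=> lsc; apply: lee_real_lt => a /lsc[V /nbhs_ballP[e /= e0 eV] Vf].
apply: ge_limn_einf.
have e20 : 0 < e / 2 by rewrite divr_gt0.
have [M MU] := Usep e20.
have /cvg_ballP/(_ _ e20)[m0 _ cm] := @limit_pointP _ _ _ Xc Usep c.
exists (maxn M m0) => // m /=; rewrite geq_max => /andP[Mm m0m].
rewrite cell_inf_truncate; apply: le_ereal_inf_tmp => _ [x /= cx <-].
apply/ltW/Vf/eV; rewrite [e]splitr; apply: ball_triangle (cm _ m0m) _.
apply: MU => i iM; have im := leq_trans iM Mm.
have : prefix_cell U c m (cell_point U c m) by apply: (@xgetI _ point _ x).
move=> /(_ _ im) E.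
by split => h; apply/codeP; [rewrite cx// -E|rewrite E -cx//]; exact/codeP.
Qed.

End integrand.

(** Fatou in the depth [m], under [lam], reduces the inequality to a fixed [m]. There the infimum
    over cells is a function of [w] and finitely many bits, to which setwise convergence applies,
    and under [mu_ n] it is below [f] because a point lies in the cell of its own code. *)
Lemma limit_measure : exists mu : probability TX R,
  (forall A, measurable A -> mu (fst @^-1` A) = P A) /\
  forall f : TX -> \bar R, measurable_fun setT f -> (forall p, 0 <= f p)%E ->
    {ae P, forall w, lower_semicontinuous (fun x : X => f (w, x))} ->
    (\int[mu]_p f p <= limn_einf (fun n => \int[mu_ n]_p f p))%E.
Proof.
have [lam lamP] := cyl_limit_measure Uopen mu_marginal mu_cvg.
have lam_fst A : measurable A -> lam (fst @^-1` A) = P A.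
  move=> mA; have dA : finite_dep (fst @^-1` A : set (cyl T)).
    by split; [exists 0%N|move=> c; exact: mA].
  have := lamP _ dA.
  rewrite (_ : (fun n => _) = cst (P A)); last first.
    by apply/funext => n; exact: mu_marginal.
  by move=> h; apply: (cvg_unique _ h) => //; exact: cvg_cst.
have lam1 : lam setT = 1%E.
  by rewrite -(preimage_setT (fst : CT -> T)) lam_fst// probability_setT.
have [pm mE] := pushforward_measure lam measurable_limit_map.
have [|mu] := @measure_probability _ _ _ pm.
  by rewrite mE /pushforward preimage_setT.
rewrite mE => muE.
exists mu; split; first by move=> A mA; rewrite muE; exact: lam_fst.
move=> f mf f0 [N [mN N0 Nlsc]].
have mcell m : measurable_fun setT (fun p : CT => cell_inf f m (truncate m p)).
  exact: measurableT_comp (measurable_cell_inf mf m) (measurable_truncate m).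
have cell0 m (p : CT) : (0 <= cell_inf f m (truncate m p))%E by exact: cell_inf_ge0.
rewrite muE (ge0_integral_pushforward measurable_limit_map)//= preimage_setT.
apply: (@le_trans _ _ (\int[lam]_p limn_einf (fun m => cell_inf f m (truncate m p)))%E).
  apply: ae_ge0_le_integral => //.
  - exact: measurableT_comp mf measurable_limit_map.
  - by move=> p _; apply: ge_limn_einf; apply: nearW => m.
  - rewrite /limn_einf; apply: (measurableT_comp (@oppe_measurable R setT)).
    by apply: measurable_fun_limn_esup => m; exact: measurableT_comp (@oppe_measurable R setT) (mcell m).
  exists (fst @^-1` N); split.
  - by rewrite -[X in measurable X]setTI; exact: measurable_cyl_fst.
  - by rewrite lam_fst.
  - move=> [w c] /= h; apply: Nlsc => /= lsc; apply: h => _.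
    exact: cell_inf_liminf.
apply: le_trans; first exact: fatou.
set c := (X in (_ <= X)%E).
have <- : limn_einf (fun=> c) = c by apply: (cvg_limn_einf_sup _).1; exact: cvg_cst.
apply: le_limn_einf => m.
apply: (le_trans (setwise_cvg_fatou_comp (mu_ := mu_) (measurable_truncate m)
  (measurable_truncate_code m) (measurable_cell_inf mf m) (cell_inf_ge0 f0 m) _)).
  by move=> B mB; exact: lamP (finite_dep_truncate m mB).
apply: le_limn_einf => n; apply: ge0_le_integral => //.
- exact: measurableT_comp (measurable_cell_inf mf m) (measurable_truncate_code m).
- by move=> p _; exact: cell_inf_le.
Qed.

End lower_semicontinuity.

(** * Fixed marginals and convergence of integrals on closed fibers *)

Lemma squeeze_limn_einf_esup (R : realType) (u : nat -> \bar R) l :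
  (limn_esup u <= l)%E -> (l <= limn_einf u)%E -> u @ \oo --> l.
Proof.
move=> ul lu; have le := limn_einf_sup u.
have E1 : limn_einf u = l by apply/eqP; rewrite eq_le lu (le_trans le ul).
have E2 : limn_esup u = l by apply/eqP; rewrite eq_le ul (le_trans lu le).
apply: (@squeeze_cvge _ _ _ _ (einfs u) _ (esups u)).
- apply: nearW => n; apply/andP; split.
    by apply: ereal_inf_lbound; exists n => /=.
  by apply: ereal_sup_ubound; exists n => /=.
- by rewrite -E1 limn_einf_lim; exact: is_cvg_einfs.
- by rewrite -E2 limn_esup_lim; exact: is_cvg_esups.
Qed.

Lemma integral_full (R : realType) d (T : measurableType d)
    (m : {measure set T -> \bar R}) (A B : set T) (f : T -> \bar R) :
  measurable A -> measurable B -> A `<=` B -> m (B `\` A) = 0%E ->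
  measurable_fun B f -> (\int[m]_(x in B) f x = \int[m]_(x in A) f x)%E.
Proof.
move=> mA mB AB BA0 mf.
have mBA : measurable (B `\` A) by exact: measurableD.
have E : B `\` (B `\` A) = A by rewrite setDD setIidr.
have h (g : T -> \bar R) : measurable_fun B g -> (forall x, B x -> 0 <= g x)%E ->
    (\int[m]_(x in B) g x = \int[m]_(x in A) g x)%E.
  by move=> mg g0; rewrite (ge0_negligible_integral mBA mB mg g0 BA0) E.
rewrite [LHS]integralE [RHS]integralE; congr (_ - _)%E; apply: h => //.
- exact: measurable_funepos.
- exact: measurable_funeneg.
Qed.

Section marginal_integral.
Context (R : realType) d (T : measurableType d) (P : probability T R)
  dX (X : measurableType dX) (m : {measure set (T * X) -> \bar R})
  (E : set (T * X)) (N : T -> \bar R).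
Hypotheses (mP : forall A, measurable A -> m (fst @^-1` A) = P A)
  (mE : measurable E) (mEC : m (~` E) = 0%E) (iN : P.-integrable setT N).

Let mN : measurable_fun setT N. Proof. exact: measurable_int iN. Qed.

Lemma ge0_integral_marginal (h : T -> \bar R) : measurable_fun setT h ->
  (forall w, 0 <= h w)%E ->
  (\int[m]_(p in E) h p.1 = \int[P]_w h w)%E.
Proof.
move=> mh h0.
have mh1 : measurable_fun setT (fun p : T * X => h p.1).
  exact: measurableT_comp mh measurable_fst.
rewrite -(integral_full mE measurableT) ?setTD//.
have -> : (\int[P]_w h w = \int[pushforward m fst]_w h w)%E.
  by apply: eq_measure_integral => A mA _; exact/esym/mP.
by rewrite (ge0_integral_pushforward measurable_fst).
Qed.

Lemma integrable_marginal : m.-integrable E (fun p => N p.1).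
Proof.
apply/integrableP; split.
  exact: measurable_funTS (measurableT_comp mN measurable_fst).
have /integrableP[_] := iN.
rewrite -(@ge0_integral_marginal (abse \o N))//; last by move=> w; exact: abse_ge0.
exact: measurableT_comp.
Qed.

Lemma integral_marginal : (\int[m]_(p in E) N p.1 = \int[P]_w N w)%E.
Proof.
rewrite [LHS]integralE [RHS]integralE; congr (_ - _)%E.
  rewrite -(ge0_integral_marginal (measurable_funepos mN)) //.
  by apply: eq_integral => p _; rewrite -[LHS]/((N \o fst)^\+%E p) funepos_comp.
rewrite -(ge0_integral_marginal (measurable_funeneg mN)) //.
by apply: eq_integral => p _; rewrite -[LHS]/((N \o fst)^\-%E p) funeneg_comp.
Qed.

End marginal_integral.

Section convergence_on_closed_fibers.
Context (R : realType) d (T : measurableType d) (P : probability T R)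
  (X : pmetricType R).
Local Notation TX := (T * borel X)%type.
Variables (mu_ : nat -> {measure set TX -> \bar R})
  (mu : {measure set TX -> \bar R}) (E : set TX).
Hypotheses (mE : measurable E)
  (Eclosed : forall w, closed (fiber E w : set X))
  (mu_P : forall n A, measurable A -> mu_ n (fst @^-1` A) = P A)
  (muP : forall A, measurable A -> mu (fst @^-1` A) = P A)
  (mu_E : forall n, mu_ n (~` E) = 0%E)
  (lsc : forall f : TX -> \bar R, measurable_fun setT f -> (forall p, 0 <= f p)%E ->
    (forall w, lower_semicontinuous (fun x : X => f (w, x))) ->
    (\int[mu]_p f p <= limn_einf (fun n => \int[mu_ n]_p f p))%E).

(* The value +oo preserves lower semicontinuity because the fibers are closed,
   and penalizes mass outside [E]. *)
Let ext (g : TX -> R) (p : TX) : \bar R := if p \in E then (g p)%:E else +oo%E.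

Let measurable_ext g : measurable_fun E g -> measurable_fun setT (ext g).
Proof.
move=> mg; apply: measurable_fun_if => //.
- apply: (measurable_fun_bool true); rewrite setTI.
  rewrite (_ : _ @^-1` _ = E)//; apply/seteqP.
  by split => p /=; [exact: set_mem|exact: mem_set].
- rewrite setTI (_ : _ @^-1` _ = E); first exact/measurable_EFinP.
  by apply/seteqP; split => p /=; [exact: set_mem|exact: mem_set].
Qed.

Let lsc_ext g w : {within (fiber E w : set X), continuous (fun x : X => g (w, x))} ->
  lower_semicontinuous (fun x : X => ext g (w, x)).
Proof.
move=> /subspace_continuousP cg x a; rewrite /ext; case: ifPn.
  rewrite inE lte_fin => Ex ax.
  have : \forall y \near within (fiber E w) (nbhs x), a < g (w, y).
    by have := cg x Ex => /cvgr_gt; apply.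
  rewrite near_withinE => h; exists [set y | E (w, y) -> a < g (w, y)] => //.
  by move=> y /= Vy; case: ifPn => [|_]; [rewrite inE => /Vy|rewrite ltry].
rewrite notin_setE => nE _; exists (~` fiber E w).
  by apply: open_nbhs_nbhs; split => //; rewrite openC.
by move=> y /= nEy; rewrite ifF ?ltry//; apply/negbTE; rewrite notin_setE.
Qed.

Lemma limit_full : mu (~` E) = 0%E.
Proof.
pose z : TX -> R := cst 0.
have m0 : measurable_fun E z by exact: measurable_cst.
have mEC : measurable (~` E) by exact: measurableC.
have ext0 p : (0 <= ext z p)%E by rewrite /ext; case: ifP.
have cz w : {within (fiber E w : set X), continuous (fun x : X => z (w, x))}.
  by apply: continuous_subspaceT => x; exact: cvg_cst.
have := lsc (measurable_ext m0) ext0 (fun w => lsc_ext (cz w)).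
have -> : (fun n => (\int[mu_ n]_p ext z p)%E) = cst 0%E.
  apply/funext => n; rewrite (integral_full mE measurableT) ?setTD//; last exact: measurable_ext.
  by rewrite integral0_eq// => p Ep; rewrite /ext mem_set.
rewrite (cvg_limn_einf_sup (cvg_cst _)).1 => le0.
apply/eqP; apply: contraPT le0 => mu0; apply/negP; rewrite -ltNge.
apply: (@lt_le_trans _ _ (\int[mu]_(p in ~` E) ext z p)%E).
  rewrite (eq_integral (cst +oo%E)); first by rewrite integral_cst// gt0_mulye ?lt0e ?mu0//= measure_ge0.
  by move=> p; rewrite inE => nE; rewrite /ext memNset.
by apply: ge0_subset_integral => //; exact: measurable_ext.
Qed.

Lemma le_liminf_closed_fibers (g : TX -> R) : measurable_fun E g ->
  (forall p, E p -> 0 <= g p) ->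
  (forall w, {within (fiber E w : set X), continuous (fun x : X => g (w, x))}) ->
  (\int[mu]_(p in E) (g p)%:E <= limn_einf (fun n => \int[mu_ n]_(p in E) (g p)%:E))%E.
Proof.
move=> mg g0 cg.
have ext0 p : (0 <= ext g p)%E.
  by rewrite /ext; case: ifPn => //; rewrite inE lee_fin; exact: g0.
have I (m : {measure set TX -> \bar R}) : m (~` E) = 0%E ->
    (\int[m]_p ext g p = \int[m]_(p in E) (g p)%:E)%E.
  move=> m0; rewrite (integral_full mE measurableT)//.
  - by apply: eq_integral => p; rewrite /ext => ->.
  - by rewrite setTD.
  - exact: measurable_ext.
rewrite -I; last exact: limit_full.
apply: le_trans (lsc (measurable_ext mg) ext0 (fun w => lsc_ext (cg w))) _.
by apply: le_limn_einf => n; rewrite I.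
Qed.

Lemma cvg_closed_fibers (f : TX -> R) (N : T -> R) :
  P.-integrable setT (EFin \o N) -> measurable_fun E f ->
  (forall p, E p -> `|f p| <= N p.1) ->
  (forall w, {within (fiber E w : set X), continuous (fun x : X => f (w, x))}) ->
  (\int[mu_ n]_(p in E) (f p)%:E)%E @[n --> \oo] --> (\int[mu]_(p in E) (f p)%:E)%E.
Proof.
move=> iN mf fN cf.
have mN1 : measurable_fun E (fun p : TX => N p.1).
  have /measurable_EFinP mN : measurable_fun setT (EFin \o N) := measurable_int _ iN.
  exact: measurable_funTS (measurableT_comp mN measurable_fst).
have If (m : {measure set TX -> \bar R}) :
    (forall A, measurable A -> m (fst @^-1` A) = P A) -> m (~` E) = 0%E ->
    m.-integrable E (EFin \o f).
  move=> mP mEC; apply: (le_integrable mE) (integrable_marginal mP mE mEC iN).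
    exact/measurable_EFinP.
  move=> p Ep /=; rewrite lee_fin (le_trans (fN _ Ep))//; exact: ler_norm.
have muE := limit_full.
have side (g : TX -> R) : measurable_fun E g -> (forall p, E p -> `|g p| <= N p.1) ->
    (forall w, {within (fiber E w : set X), continuous (fun x : X => g (w, x))}) ->
    (forall m : {measure set TX -> \bar R},
      (forall A, measurable A -> m (fst @^-1` A) = P A) -> m (~` E) = 0%E ->
      m.-integrable E (EFin \o g)) ->
    (\int[mu]_(p in E) (g p)%:E <= limn_einf (fun n => \int[mu_ n]_(p in E) (g p)%:E))%E.
  move=> mg gN cg Ig.
  (* All the measures give [N] the same finite integral, their marginal being [P], so it cancels
     from the inequality. *)
  have IS (m : {measure set TX -> \bar R}) :
      (forall A, measurable A -> m (fst @^-1` A) = P A) -> m (~` E) = 0%E ->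
      (\int[m]_(p in E) (N p.1 + g p)%:E =
       \int[P]_w (N w)%:E + \int[m]_(p in E) (g p)%:E)%E.
    move=> mP mEC; rewrite -(integral_marginal mP mE mEC iN).
    rewrite -integralD_EFin//; last exact: Ig.
    exact: (integrable_marginal mP mE mEC iN).
  have := @le_liminf_closed_fibers (fun p => N p.1 + g p).
  rewrite IS// (_ : (fun n => _) = (fun n =>
    \int[P]_w (N w)%:E + \int[mu_ n]_(p in E) (g p)%:E)%E); last first.
    by apply/funext => n; exact: IS (mu_P n) (mu_E n).
  rewrite limn_einf_shift; last exact: integrable_fin_num.
  rewrite leeD2lE; last exact: integrable_fin_num.
  apply; first exact: measurable_funD.
    by move=> p Ep; rewrite -lerBlDl sub0r; have := gN _ Ep; rewrite ler_norml => /andP[].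
  by move=> w x; apply: cvgD; [exact: cvg_cst|exact: cg].
apply: squeeze_limn_einf_esup; last exact: side.
rewrite -leeN2 -limn_einfN.
have := side (\- f).
have EN (m : {measure set TX -> \bar R}) :
    (forall A, measurable A -> m (fst @^-1` A) = P A) -> m (~` E) = 0%E ->
    (\int[m]_(p in E) ((\- f) p)%:E = - \int[m]_(p in E) (f p)%:E)%E.
  move=> mP mEC; rewrite -integralN//; last exact/integrable_add_def/If.
rewrite EN// (_ : (fun n => _) =
    -%E \o (fun n => \int[mu_ n]_(p in E) (f p)%:E))%E; last first.
  by apply/funext => n; exact: EN (mu_P n) (mu_E n).
apply.
- exact: measurable_funN.
- by move=> p /fN; rewrite /= normrN.
- by move=> w x; apply: cvgN; exact: cf.
- move=> m mP mEC; rewrite (_ : _ \o _ = \- (EFin \o f))%E//; exact/integrableN/If.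
Qed.

End convergence_on_closed_fibers.

(** * Extraction of the subsequence *)

Section compactness.
Context (R : realType) d (T : measurableType d) (P : probability T R)
  (X : pmetricType R).
Local Notation TX := (T * borel X)%type.

(** A cell of depth [m] is named by a finite bit string, so the products of the test sets [G k] with
    cells are countably many. With the cell fixed, the masses are dominated by [P], and convergence
    spreads to every measurable [A]. *)
Lemma setwise_convergent_subsequence (U : nat -> set X)
    (mu_ : nat -> {measure set TX -> \bar R}) :
  lebesgue_space P -> (forall i, open (U i)) ->
  (forall n A, measurable A -> mu_ n (fst @^-1` A) = P A) ->
  exists2 n_ : nat -> nat, increasing_seq n_ &
    forall A c m, measurable A ->
      cvgn (fun j => fine (mu_ (n_ j) (A `*` prefix_cell U c m))).
Proof.
move=> Pleb Uopen muP; have [G mG Gcvg] := lebesgue_space_setwise_cvg Pleb.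
have mX A c m : measurable A -> measurable (A `*` prefix_cell U c m : set TX).
  by move=> mA; apply: measurableX => //; exact: measurable_prefix_cell.
have bound n A c m : measurable A ->
    0 <= fine (mu_ n (A `*` prefix_cell U c m)) <= fine (P A).
  move=> mA; rewrite fine_ge0//= fine_le//.
  - by apply: (mu_fin muP); exact: mX.
  - exact: fin_num_measure.
  - rewrite -(muP n _ mA); apply: le_measure; rewrite ?inE; [exact: mX| |by move=> p []].
    by rewrite -[X in measurable X]setTI; exact: measurable_fst.
pose code3 (k : nat) : nat * (seq bool * nat) :=
  odflt (0%N, ([::], 0%N)) (choice.unpickle k).
pose a k n := let q := code3 k in
  fine (mu_ n (G q.1 `*` prefix_cell U (nth false q.2.1) q.2.2)).
have [|n_ incn an] := @common_subsequence R a.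
  move=> k n; have /andP[-> /le_trans ->]// := bound n _ (nth false (code3 k).2.1) (code3 k).2.2 (mG (code3 k).1).
  by rewrite -lee_fin fineK ?fin_num_measure// probability_le1.
exists n_ => // A c m mA.
apply: (Gcvg (fun j A => fine (mu_ (n_ j) (A `*` prefix_cell U c m)))) => //.
  move=> j; split; first by move=> B mB; exact: bound.
  move=> B C mB mC BC.
  rewrite (_ : (B `|` C) `*` _ =
      (B `*` prefix_cell U c m) `|` (C `*` prefix_cell U c m)); last first.
    by apply/seteqP; split => p; [move=> [[|]]|move=> [[]|[]]];
      rewrite /setX/=; tauto.
  rewrite measureU//; [|exact: mX|exact: mX|].
    by rewrite fineD// (mu_fin muP)//; exact: mX.
  apply/seteqP; split => // p [[Bp _] [Cp _]].
  by have : (B `&` C) p.1 by []; rewrite BC.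
move=> k; have := an (choice.pickle (k, (mkseq c m, m))).
rewrite /a /code3 /comp; set q := odflt _ _.
have -> : q = (k, (mkseq c m, m)) by rewrite /q choice.pickleK.
rewrite /= (@prefix_cell_ext _ _ U (nth false (mkseq c m)) c)//.
by move=> i im; rewrite nth_mkseq.
Qed.

Lemma lsc_compactness (mu_ : nat -> {measure set TX -> \bar R}) :
  lebesgue_space P -> compact [set: X] ->
  (forall n A, measurable A -> mu_ n (fst @^-1` A) = P A) ->
  exists2 n_ : nat -> nat, increasing_seq n_ &
  exists mu : probability TX R,
  (forall A, measurable A -> mu (fst @^-1` A) = P A) /\
  forall f : TX -> \bar R, measurable_fun setT f -> (forall p, 0 <= f p)%E ->
    (forall w, lower_semicontinuous (fun x : X => f (w, x))) ->
    (\int[mu]_p f p <= limn_einf (fun j => \int[mu_ (n_ j)]_p f p))%E.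
Proof.
move=> Pleb Xc muP; have [U Uopen Usep] := compact_separating_sequence Xc.
have [n_ incn cn] := setwise_convergent_subsequence Pleb Uopen muP.
have Pc : measure_is_complete P by case: Pleb.
exists n_ => //; have [mu [mu1 mu2]] := @limit_measure _ _ _ _ _ _ Pc Xc Uopen Usep
  (fun j => mu_ (n_ j)) (fun j => muP (n_ j)) cn.
exists mu; split => // f mf f0 lf; apply: mu2 => //.
exact: aeW.
Qed.

End compactness.

(** * Compactness of measures on the bundle *)

Section bundle_compactness.
Context (G : groupType) (R : realType) d (Omega : measurableType d)
  (P : probability Omega R) (T : mp_action G P) (X : pmetricType R)
  (S : bundle_rds T X).
Local Notation E := (bundle S).
Local Notation OX := (Omega * borel X)%type.

Lemma in_PPE_full (m : {measure set OX -> \bar R}) : in_PPE S m -> m (~` E) = 0%E.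
Proof.
move=> [mP mE1]; have mE := measurable_bundle S.
have mT : m setT = 1%E by rewrite -(preimage_setT fst) mP// probability_setT.
have -> : m (~` E) = (m setT - m (setT `&` E))%E.
  have mfin : (m setT < +oo)%E by rewrite mT ltry.
  by rewrite -setTD; exact: measureD.
by rewrite setTI mT mE1 subee.
Qed.

Lemma compact_fibers_closed w : [/\ fiber E w !=set0, compact (fiber E w : set X) &
  forall g, {within (fiber E w : set X), continuous (rmap S g w)}] ->
  closed (fiber E w : set X).
Proof. by move=> [_ cE _]; apply: compact_closed => //; exact: metric_hausdorff. Qed.

(* Emptying the fibers over a null set [Z] makes almost sure properties of the
   fibers hold everywhere. *)
Definition bundle_restr (Z : set Omega) : set OX := E `&` fst @^-1` (~` Z).

Lemma measurable_bundle_restr Z : measurable Z -> measurable (bundle_restr Z).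
Proof.
move=> mZ; apply: measurableI; first exact: measurable_bundle.
by rewrite -[X in measurable X]setTI; apply: measurable_fst => //; exact: measurableC.
Qed.

Lemma fiber_bundle_restr Z w : fiber (bundle_restr Z) w =
  if pselect (Z w) then set0 else fiber E w.
Proof.
by apply/seteqP; split => x; rewrite /fiber /bundle_restr /=; case: pselect => //= Zw [].
Qed.

Lemma bundle_restr_full Z (m : {measure set OX -> \bar R}) :
  (forall A, measurable A -> m (fst @^-1` A) = P A) -> m (~` E) = 0%E ->
  measurable Z -> P Z = 0%E -> m (~` bundle_restr Z) = 0%E.
Proof.
move=> mP mE mZ Z0; rewrite /bundle_restr setCI -preimage_setC setCK.
apply: null_set_setU => //.
- by apply: measurableC; exact: measurable_bundle.
- by rewrite -[X in measurable X]setTI; exact: measurable_fst.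
- by rewrite mP.
Qed.

(** Stated with an integrable bound and almost sure conditions instead of [L1E], so that it also
    covers a test function composed with [skew g], whose continuity is known on almost every fiber
    only. *)
Lemma bundle_compactness (mu_ : nat -> {measure set OX -> \bar R}) :
  lebesgue_space P -> compact [set: X] -> (forall n, in_PPE S (mu_ n)) ->
  exists2 n_ : nat -> nat, increasing_seq n_ &
  exists mu : probability OX R, in_PPE S mu /\
  forall (f : OX -> R) (N : Omega -> R), P.-integrable setT (EFin \o N) ->
    measurable_fun E f ->
    {ae P, forall w, forall x, E (w, x) -> `|f (w, x)| <= N w} ->
    {ae P, forall w, {within (fiber E w : set X), continuous (fun x : X => f (w, x))}} ->
    (\int[mu_ (n_ j)]_(p in E) (f p)%:E)%E @[j --> \oo] -->
    (\int[mu]_(p in E) (f p)%:E)%E.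
Proof.
move=> Pleb Xc mu_S; have mE := measurable_bundle S.
have [n_ incn [mu [muP lsc]]] := lsc_compactness Pleb Xc (fun n => (mu_S n).1).
have clZ Z : ~` [set w | closed (fiber E w : set X)] `<=` Z ->
    forall w, closed (fiber (bundle_restr Z) w : set X).
  move=> cZ w; rewrite fiber_bundle_restr; case: pselect => // Zw; first exact: closed0.
  by apply: contrapT => /cZ.
have clE : {ae P, forall w, closed (fiber E w : set X)}.
  by apply: filterS (bundle_regular S) => w; exact: compact_fibers_closed.
have muE0 : mu (~` E) = 0%E.
  have [Z [mZ Z0 ZE]] := clE.
  have mZE := measurable_bundle_restr mZ.
  have h := @limit_full _ _ _ _ (fun j => mu_ (n_ j)) mu _ mZE (clZ _ ZE).
  apply: (subset_measure0 (mu := mu)) (h _ lsc) => //.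
  - exact: measurableC.
  - exact: measurableC.
  - by apply: subsetC => p [].
  - by move=> j; apply: bundle_restr_full => //; [exact: (mu_S _).1|exact: in_PPE_full].
exists n_ => //; exists mu; split.
  split => //; rewrite -(setCK E) probability_setC; last exact: measurableC.
  by rewrite muE0 sube0.
move=> f N iN mf fN cf.
have [Z [mZ Z0 ZE]] := filterI clE (filterI fN cf).
have mZE := measurable_bundle_restr mZ.
have full (m : {measure set OX -> \bar R}) :
    (forall A, measurable A -> m (fst @^-1` A) = P A) -> m (~` E) = 0%E ->
    (\int[m]_(p in E) (f p)%:E = \int[m]_(p in bundle_restr Z) (f p)%:E)%E.
  move=> mP mEC; apply: integral_full => //; first by move=> p [].
    apply: (subset_measure0 (mu := m)) (bundle_restr_full mP mEC mZ Z0).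
    - exact: measurableD.
    - exact: measurableC.
    - by move=> p [].
  exact/measurable_EFinP.
have outZ w : ~ Z w -> [/\ closed (fiber E w : set X),
    forall x, E (w, x) -> `|f (w, x)| <= N w &
    {within (fiber E w : set X), continuous (fun x : X => f (w, x))}].
  move=> nZ; apply: contrapT => h; apply: nZ; apply: ZE => -[? [? ?]].
  exact: h.
rewrite (full mu muP muE0).
rewrite (_ : (fun j => _) = (fun j => \int[mu_ (n_ j)]_(p in bundle_restr Z) (f p)%:E))%E; last first.
  by apply/funext => j; apply: full; [exact: (mu_S _).1|exact: in_PPE_full].
apply: (@cvg_closed_fibers _ _ _ P _ _ _ _ mZE _ _ muP _ lsc f N) => //.
- move=> w; rewrite fiber_bundle_restr; case: pselect => Zw /=.
    exact: closed0.
  by have [] := outZ _ Zw.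
- by move=> j; exact: (mu_S _).1.
- by move=> j; apply: bundle_restr_full => //; [exact: (mu_S _).1|exact: in_PPE_full].
- by apply: measurable_funS mf => // p [].
- by move=> [w x] [Ewx /outZ[_ h _]]; exact: h.
- move=> w; rewrite fiber_bundle_restr; case: pselect => Zw /=.
    by apply/subspace_continuousP => x.
  by have [] := outZ _ Zw.
Qed.

End bundle_compactness.

(* [skew] is also the name of a predicate on sesquilinear forms. *)
Local Notation skew := Defs.skew.

(** * Integrals against translated and averaged measures *)

Section bundle_integrals.
Context (G : groupType) (R : realType) d (Omega : measurableType d)
  (P : probability Omega R) (T : mp_action G P) (X : pmetricType R)
  (S : bundle_rds T X).
Local Notation E := (bundle S).
Local Notation OX := (Omega * borel X)%type.
Implicit Types (g h : G) (K : {fset G}).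

Lemma skew_bundle g p : E p -> E (skew S g p).
Proof. by case: p => w x; exact: rmap_fiber. Qed.

Lemma skewM g h p : E p -> skew S (g * h)%g p = skew S g (skew S h p).
Proof. by case: p => w x Ep; rewrite /skew/= Defs.actM Defs.rmapM. Qed.

(* [skew g] is only controlled on the bundle; this extension by the identity
   is measurable everywhere. *)
Definition tskew g (p : OX) : OX := if p \in E then skew S g p else p.

Lemma measurable_tskew g : measurable_fun setT (tskew g).
Proof.
have mE := measurable_bundle S.
have EE : (fun p => p \in E) @^-1` [set true] = E.
  by apply/seteqP; split => p /=; [exact: set_mem|exact: mem_set].
apply: measurable_fun_if => //.
- by apply: (measurable_fun_bool true); rewrite setTI EE.
- by rewrite setTI EE; exact: measurable_skew.
Qed.

Lemma tskew_preimage g : tskew g @^-1` E = E.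
Proof.
apply/seteqP; split => p; rewrite /preimage/= /tskew; case: ifPn => //.
- by move=> /set_mem.
- by move=> _ Ep; exact: skew_bundle.
Qed.

Section one_measure.
Variable nu : {measure set OX -> \bar R}.
Hypothesis nu_PPE : in_PPE S nu.

Lemma in_PPE_setI A : measurable A -> nu (E `&` A) = nu A.
Proof.
move=> mA; have mE := measurable_bundle S; have mEC := measurableC mE.
have mEA : measurable (E `&` A) by exact: measurableI.
apply/eqP; rewrite eq_le le_measure ?inE//=.
rewrite -(measureU0 mEA mEC (in_PPE_full nu_PPE)) le_measure ?inE//.
  exact: measurableU.
by move=> p Ap; have [Ep|nEp] := pselect (E p); [left|right].
Qed.

Lemma gpush_tskew g A : measurable A -> gpush S g nu A = nu (tskew g @^-1` A).
Proof.
move=> mA; have mE := measurable_bundle S.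
have mT : measurable (tskew g @^-1` A).
  by rewrite -[X in measurable X]setTI; exact: measurable_tskew.
have mS : measurable (E `&` skew S g @^-1` A) by exact: measurable_skew.
rewrite /gpush -(in_PPE_setI mT); congr (nu _).
by apply/seteqP; split => p [Ep] Ap; split => //; move: Ap;
  rewrite /preimage/= /tskew mem_set.
Qed.

Lemma in_PPE_gpush g : in_PPE S (gpush S g nu).
Proof.
have mE := measurable_bundle S.
split => [A mA|]; last by rewrite gpush_tskew// tskew_preimage (nu_PPE.2).
have mfA : measurable (fst @^-1` A : set OX).
  by rewrite -[X in measurable X]setTI; exact: measurable_fst.
have mTA : measurable (T g @^-1` A).
  by rewrite -[X in measurable X]setTI; exact: measurable_act.
rewrite /gpush -(act_preserving T g mA) -(nu_PPE.1 _ mTA).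
have mF : measurable (fst @^-1` (T g @^-1` A) : set OX).
  by rewrite -[X in measurable X]setTI; exact: measurable_fst.
exact: (in_PPE_setI mF).
Qed.

Lemma ge0_integral_gpush g (f : OX -> \bar R) : measurable_fun E f ->
  (forall p, E p -> 0 <= f p)%E ->
  (\int[gpush S g nu]_(p in E) f p = \int[nu]_(p in E) f (skew S g p))%E.
Proof.
move=> mf f0; have mE := measurable_bundle S.
have [pm pmE] := pushforward_measure nu (measurable_tskew g).
rewrite (eq_measure_integral pm); last first.
  by move=> A mA _; rewrite pmE; exact: gpush_tskew.
rewrite pmE.
rewrite (ge0_integral_pushforward (measurable_tskew g))// ?tskew_preimage; last first.
  by move=> p; rewrite inE; exact: f0.
by apply: eq_integral => p Ep /=; rewrite /tskew Ep.
Qed.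

Lemma gavgE K : gavg S K nu =
  mscale ((#|` K|%:R^-1)%:nng)%R
    (msum (fun i => gpush S (nth 1%g K i) nu) #|` K|).
Proof.
apply/funext => A; rewrite /gavg /mscale /msum /=; congr (_ * _)%E.
by rewrite (big_nth 1%g) big_mkord.
Qed.

Lemma ge0_integral_gavg K (f : OX -> \bar R) : measurable_fun E f ->
  (forall p, E p -> 0 <= f p)%E ->
  (\int[gavg S K nu]_(p in E) f p =
   (#|` K|%:R^-1)%:E * \sum_(g <- K) \int[nu]_(p in E) f (skew S g p))%E.
Proof.
move=> mf f0; have mE := measurable_bundle S.
rewrite gavgE ge0_integral_mscale//; congr (_ * _)%E.
rewrite ge0_integral_measure_sum// (big_nth 1%g) big_mkord.
by apply: eq_bigr => i _; exact: ge0_integral_gpush.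
Qed.

Lemma in_PPE_gavg K : K != fset0 -> in_PPE S (gavg S K nu).
Proof.
move=> K0; have kn0 : #|` K|%:R != 0 :> R by rewrite pnatr_eq0 cardfs_eq0.
have avg (a : \bar R) : a \is a fin_num ->
    ((#|` K|%:R^-1)%:E * \sum_(g <- K) a = a)%E.
  move=> /fineK <-; rewrite sumEFin -EFinM big_const_seq count_predT iter_addr_0.
  by rewrite -(mulr_natl (fine a)) mulrA mulVf// mul1r.
split => [A mA|].
  rewrite /gavg (eq_bigr (fun=> P A)); first by rewrite avg// fin_num_measure.
  by move=> g _; exact: (in_PPE_gpush g).1.
rewrite /gavg (eq_bigr (fun=> 1%E)); first exact: avg.
by move=> g _; exact: (in_PPE_gpush g).2.
Qed.

Lemma integral_gavg K (f : OX -> R) : measurable_fun E f ->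
  (forall g, nu.-integrable E (fun p => (f (skew S g p))%:E)) ->
  (\int[gavg S K nu]_(p in E) (f p)%:E =
   (#|` K|%:R^-1)%:E * \sum_(g <- K) \int[nu]_(p in E) (f (skew S g p))%:E)%E.
Proof.
move=> mf If; have mE := measurable_bundle S.
have mf' : measurable_fun E (EFin \o f) by exact/measurable_EFinP.
rewrite integralE [X in (X - _)%E]ge0_integral_gavg//; last exact: measurable_funepos.
rewrite [X in (_ - X)%E]ge0_integral_gavg//; last exact: measurable_funeneg.
pose h g p := (f (skew S g p))%:E.
have hp g : (\int[nu]_(p in E) (EFin \o f)^\+ (skew S g p) =
    \int[nu]_(p in E) (h g)^\+ p)%E.
  by apply: eq_integral => p _; rewrite -[h g]/((EFin \o f) \o skew S g) (funepos_comp (EFin \o f) (skew S g)).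
have hn g : (\int[nu]_(p in E) (EFin \o f)^\- (skew S g p) =
    \int[nu]_(p in E) (h g)^\- p)%E.
  by apply: eq_integral => p _; rewrite -[h g]/((EFin \o f) \o skew S g) (funeneg_comp (EFin \o f) (skew S g)).
have fp g : (\int[nu]_(p in E) (h g)^\+ p)%E \is a fin_num.
  by apply: (integrable_fin_num mE); apply: integrable_funepos => //; exact: If.
have fn g : (\int[nu]_(p in E) (h g)^\- p)%E \is a fin_num.
  by apply: (integrable_fin_num mE); apply: integrable_funeneg => //; exact: If.
under eq_bigr do rewrite hp -(fineK (fp _)).
under [X in (_ - _ * X)%E]eq_bigr do rewrite hn -(fineK (fn _)).
under [X in _ = (_ * X)%E]eq_bigr do rewrite integralE -(fineK (fp _)) -(fineK (fn _)) -EFinB.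
by rewrite !sumEFin -!EFinM -EFinB -mulrBr sumrB.
Qed.

End one_measure.
End bundle_integrals.

(** * Invariance of the limit *)

Section fset_sums.
Context (R : realDomainType) (G : choiceType).
Implicit Types (A B : {fset G}) (a : G -> R).

Lemma sum_fset_split A B a : \sum_(g <- A) a g =
  \sum_(g <- (A `&` B)%fset) a g + \sum_(g <- (A `\` B)%fset) a g.
Proof.
rewrite (big_fsetID _ (mem B))/=; congr (_ + _);
  by congr (\sum_(g <- enum_fset _) _); apply/fsetP => x; rewrite !inE // andbC.
Qed.

Lemma sum_fset_norm_le A a (b : R) : (forall g, g \in A -> `|a g| <= b) ->
  `|\sum_(g <- A) a g| <= b * #|` A|%:R.
Proof.
move=> ab; apply: (le_trans (ler_norm_sum _ _ _)).
have -> : b * #|` A|%:R = \sum_(g <- A) b.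
  by rewrite big_const_seq count_predT iter_addr_0 mulr_natr.
by rewrite big_seq [leRHS]big_seq; apply: ler_sum => g /ab.
Qed.

Lemma sum_fset_symdiff_le A B a (b : R) : (forall g, `|a g| <= b) ->
  `|\sum_(g <- A) a g - \sum_(g <- B) a g| <=
  b * #|` ((A `\` B) `|` (B `\` A))%fset|%:R.
Proof.
move=> ab; rewrite (sum_fset_split A B) (sum_fset_split B A) fsetIC.
rewrite opprD addrACA subrr add0r.
have dis : ((A `\` B) `&` (B `\` A))%fset = fset0.
  by apply/fsetP => x; rewrite !inE; case: (x \in A); case: (x \in B).
rewrite cardfsU dis cardfs0 subn0 natrD mulrDr.
apply: (le_trans (ler_normB _ _)).
by apply: lerD; apply: sum_fset_norm_le.
Qed.

End fset_sums.

Section product_measures_test_functions.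
Context (R : realType) d (T : measurableType d) (X : pmetricType R).
Local Notation TX := (T * borel X)%type.

Lemma continuous_measurable_borel (psi : X -> R) : continuous psi ->
  measurable_fun setT (psi : borel X -> R).
Proof.
move=> /continuousP cpsi.
apply: (measurability _ (RGenOpens.measurableE R)) => _ [_ [x [y ->]] <-].
rewrite setTI; apply: sub_sigma_algebra; apply: cpsi; exact: interval_open.
Qed.

Definition test_function (B : set T) (psi : X -> R) (p : TX) : R :=
  \1_B p.1 * psi p.2.

Lemma measurable_test_function B psi : measurable B -> continuous psi ->
  measurable_fun setT (test_function B psi).
Proof.
move=> mB cpsi; apply: measurable_funM.
  exact: measurableT_comp (measurable_indic _) measurable_fst.
exact: measurableT_comp (continuous_measurable_borel cpsi) measurable_snd.
Qed.

Lemma test_function_bounds B psi p : (forall x, 0 <= psi x <= 1) ->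
  0 <= test_function B psi p <= 1.
Proof.
move=> psi01; have /andP[p0 p1] := psi01 p.2.
by rewrite /test_function indicE; case: (_ \in _); rewrite ?mul1r ?mul0r ?p0 ?lexx ?ler01.
Qed.

(** A Urysohn function equal to 1 on [F n] and to 0 off [V] lies between the two indicators, and the
    closed sets [F n] increase to [V]. *)
Lemma test_functions_le (m1 m2 : {measure set TX -> \bar R}) :
  (forall (B : set T) (psi : X -> R), measurable B -> continuous psi -> (forall x, 0 <= psi x <= 1) ->
    (\int[m1]_p (test_function B psi p)%:E <= \int[m2]_p (test_function B psi p)%:E)%E) ->
  forall B (V : set X), measurable B -> open V -> (m1 (B `*` V) <= m2 (B `*` V))%E.
Proof.
move=> h B V mB oV.
have [F [cF ndF FV]] := open_sigma_closed oV.
have mX (K : set X) : measurable (K : set (borel X)) -> measurable (B `*` K : set TX).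
  by move=> mK; exact: measurableX.
have mV : measurable (V : set (borel X)) by exact: sub_sigma_algebra.
have mF n : measurable (F n : set (borel X)).
  rewrite -(setCK (F n)); apply: measurableC; apply: sub_sigma_algebra.
  exact: closed_openC.
have sep n : uniform_separator (~` V) (F n).
  have /normal_separatorP := @pseudometric_normal R X; apply => //.
    exact: open_closedC.
  by rewrite setIC disjoints_subset setCK FV; exact: bigcup_sup.
have le n : (m1 (B `*` F n) <= m2 (B `*` V))%E.
  pose psi : X -> R := Urysohn (~` V) (F n).
  have psi01 x : 0 <= psi x <= 1.
    have := @Urysohn_range X R (~` V) (F n) (psi x).
    by rewrite /= in_itv/=; apply; exists x.
  have cpsi : continuous psi by exact: Urysohn_continuous.
  have mt := measurable_test_function mB cpsi.
  apply: (@le_trans _ _ (\int[m1]_p (test_function B psi p)%:E)%E).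
    rewrite -(setIT (B `*` F n)) -(integral_indic m1)//; last exact: mX.
    apply: ge0_le_integral => //.
    - by apply/measurable_EFinP; apply: measurable_indic; exact: mX.
    - exact/measurable_EFinP.
    move=> p _; rewrite lee_fin indicE.
    have [|_] := boolP (p \in B `*` F n); last first.
      by have /andP[] := test_function_bounds B p psi01.
    rewrite inE => -[Bp Fp]; rewrite /test_function indicE mem_set// mul1r.
    by have /(_ (psi p.2)) -> := Urysohn_sub1 (R := R) (sep n); last by exists p.2.
  apply: le_trans (h _ _ mB cpsi psi01) _.
  rewrite -[X in m2 X](setIT) -(integral_indic m2)//; last exact: mX.
  apply: ge0_le_integral => //.
  - by move=> p _; rewrite lee_fin; have /andP[] := test_function_bounds B p psi01.
  - exact/measurable_EFinP.
  - by apply/measurable_EFinP; apply: measurable_indic; exact: mX.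
  move=> p _; rewrite lee_fin indicE.
  have [|nBV] := boolP (p \in B `*` V).
    by have /andP[] := test_function_bounds B p psi01.
  rewrite /test_function indicE.
  have [/set_mem Bp|] := boolP (p.1 \in B); last by rewrite mul0r.
  have nVp : (~` V) p.2 by move=> Vp; move/negP : nBV; apply; rewrite inE.
  by rewrite mul1r; have /(_ (psi p.2)) -> := Urysohn_sub0 (R := R) (sep n); last by exists p.2.
have BV : B `*` V = \bigcup_n (B `*` F n) by rewrite FV setX_bigcupr.
have cv : (m1 \o (fun n => B `*` F n)) n @[n --> \oo] --> m1 (B `*` V).
  rewrite BV; apply: (nondecreasing_cvg_mu (mu := m1)).
  - by move=> n; exact: mX.
  - by rewrite -BV; exact: mX.
  - by move=> m n mn; apply/subsetPset => p [Bp Fp]; split => //; exact: (ndF _ _ mn).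
rewrite -(cvg_lim _ cv)//; apply: lime_le; first by apply/cvg_ex; eexists; exact: cv.
exact: nearW.
Qed.

(** Rectangles with an open second side are stable under intersection and generate the product
    sigma-algebra, so equality on them suffices. *)
Lemma test_functions_eq (m1 m2 : {measure set TX -> \bar R}) :
  (m1 setT < +oo)%E ->
  (forall (B : set T) (psi : X -> R), measurable B -> continuous psi -> (forall x, 0 <= psi x <= 1) ->
    (\int[m1]_p (test_function B psi p)%:E = \int[m2]_p (test_function B psi p)%:E)%E) ->
  forall A, measurable A -> m1 A = m2 A.
Proof.
move=> m1fin h A mA.
pose G := [set C : set TX | exists B (V : set X),
  [/\ measurable B, open V & C = B `*` V]].
apply: (@measure_unique _ R _ G (fun=> setT) _ _ _ _ m1 m2 _ _ A mA) => //.
- rewrite measurable_prod_measurableType; apply/seteqP; split; last first.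
    apply: smallest_sub; first exact: smallest_sigma_algebra.
    move=> _ [B [V [mB oV ->]]]; apply: sub_sigma_algebra.
    by exists B => //; exists V => //; exact: sub_sigma_algebra.
  apply: smallest_sub; first exact: smallest_sigma_algebra.
  move=> _ [B mB [K mK <-]].
  have mG1 : <<s G >> (B `*` setT).
    apply: sub_sigma_algebra; exists B, setT; split => //; exact: openT.
  have msnd : measurable_fun setT (snd : g_sigma_algebraType G -> borel X).
    apply: (@measurability _ _ (g_sigma_algebraType G) (borel X) setT snd (@open X)) => //.
    move=> _ [V oV <-]; apply: sub_sigma_algebra; exists setT, V; split => //.
  have mG2 : <<s G >> (setT `*` K : set TX).
    have := msnd measurableT _ mK; congr (<<s G >> _).
  rewrite -(setIT B) -(setTI K) setXI.
  exact: (@measurableI _ (g_sigma_algebraType G) _ _ mG1 mG2).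
- move=> _ _ [B [V [mB oV ->]]] [C [W [mC oW ->]]].
  exists (B `&` C), (V `&` W); rewrite setXI; split => //.
    exact: measurableI.
  exact: openI.
- by move=> _; exists setT, setT; rewrite setXTT; split => //; exact: openT.
- by rewrite bigcup_const.
- move=> _ [B [V [mB oV ->]]]; apply/eqP; rewrite eq_le.
  apply/andP; split; apply: test_functions_le => // C psi mC cpsi psi01;
    by rewrite h.
Qed.

End product_measures_test_functions.

Lemma increasing_subseq_cvg {Y : topologicalType} (u : nat -> Y) (n_ : nat -> nat) (l : Y) :
  increasing_seq n_ -> u n @[n --> \oo] --> l -> u (n_ j) @[j --> \oo] --> l.
Proof.
move=> n_inc ul; have nj j : (j <= n_ j)%N.
  elim: j => // j IH; apply: leq_ltn_trans IH _.
  by move/increasing_seqP : n_inc => /(_ j); rewrite ltEnat.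
move=> V Vl; have [N _ NV] := ul _ Vl; exists N => // j /= Nj.
by apply: NV => /=; exact: leq_trans (nj j).
Qed.

Section invariance.
Context (G : groupType) (R : realType) d (Omega : measurableType d)
  (P : probability Omega R) (T : mp_action G P) (X : pmetricType R)
  (S : bundle_rds T X).
Local Notation E := (bundle S).
Local Notation OX := (Omega * borel X)%type.
Implicit Types (g h : G) (K : {fset G}).

Lemma PPE_integral_unit (nu : {measure set OX -> \bar R}) (f : OX -> R) :
  in_PPE S nu -> measurable_fun E f -> (forall p, 0 <= f p <= 1) ->
  (\int[nu]_(p in E) (f p)%:E)%E \is a fin_num /\
  0 <= fine (\int[nu]_(p in E) (f p)%:E)%E <= 1.
Proof.
move=> nuS mf f01; have mE := measurable_bundle S.
have ge0 : (0 <= \int[nu]_(p in E) (f p)%:E)%E.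
  by apply: integral_ge0 => p _; rewrite lee_fin; have /andP[] := f01 p.
have le1 : (\int[nu]_(p in E) (f p)%:E <= 1)%E.
  rewrite -nuS.2 -[leRHS]mul1e -(integral_cst nu mE).
  apply: ge0_le_integral => //.
  - by move=> p _; rewrite lee_fin; have /andP[] := f01 p.
  - exact/measurable_EFinP.
  - by move=> p _; rewrite lee_fin; have /andP[] := f01 p.
have fin : (\int[nu]_(p in E) (f p)%:E)%E \is a fin_num.
  by rewrite ge0_fin_numE// (le_lt_trans le1)// ltry.
by split => //; rewrite fine_ge0//= -lee_fin fineK.
Qed.

(** Averaging [f] composed with [skew g] over [K] amounts to summing over [g K]; only the symmetric
    difference with [K] remains, and each of its terms is at most 1. *)
Lemma gavg_skew_diff (nu : {measure set OX -> \bar R}) (f : OX -> R) g K :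
  in_PPE S nu -> measurable_fun setT f -> (forall p, 0 <= f p <= 1) ->
  `|fine (\int[gavg S K nu]_(p in E) (f (skew S g p))%:E)%E -
    fine (\int[gavg S K nu]_(p in E) (f p)%:E)%E| <=
  #|` fsymdiff (ltrans g K) K|%:R / #|` K|%:R.
Proof.
move=> nuS mf f01; have mE := measurable_bundle S.
have mfs h : measurable_fun E (fun p => f (skew S h p)).
  exact: measurableT_comp mf (@measurable_skew _ _ _ _ _ _ _ S h).
pose J h := fine (\int[nu]_(p in E) (f (skew S h p))%:E)%E.
have JE h : (\int[nu]_(p in E) (f (skew S h p))%:E)%E = (J h)%:E.
  by rewrite fineK//; have [] := PPE_integral_unit nuS (mfs h) (fun p => f01 _).
have J1 h : `|J h| <= 1.
  have [_ /andP[J0 ?]] := PPE_integral_unit nuS (mfs h) (fun p => f01 _).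
  by rewrite ger0_norm.
have f0 p : E p -> (0 <= (f p)%:E)%E.
  by move=> _; rewrite lee_fin; have /andP[] := f01 p.
have -> : fine (\int[gavg S K nu]_(p in E) (f p)%:E)%E =
    #|` K|%:R^-1 * \sum_(h <- K) J h.
  rewrite ge0_integral_gavg//; last exact/measurable_EFinP/measurable_funTS.
  by rewrite (eq_bigr (EFin \o J))//= sumEFin -EFinM.
have -> : fine (\int[gavg S K nu]_(p in E) (f (skew S g p))%:E)%E =
    #|` K|%:R^-1 * \sum_(h <- ltrans g K) J h.
  rewrite ge0_integral_gavg//.
  - rewrite big_imfset/=; last by move=> h1 h2 _ _; exact: mulgI.
    rewrite (eq_bigr (fun h => (J (g * h)%g)%:E)); last first.
      move=> h _; rewrite -JE; apply: eq_integral => p; rewrite inE => Ep.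
      by rewrite skewM.
    by rewrite sumEFin -EFinM.
  - exact/measurable_EFinP.
  - by move=> p _; rewrite lee_fin; have /andP[] := f01 (skew S g p).
rewrite -mulrBr normrM ger0_norm// mulrC ler_wpM2r//.
by rewrite -[leRHS]mul1r; exact: sum_fset_symdiff_le.
Qed.

Variables (Fn : nat -> {fset G}) (nu : nat -> {measure set OX -> \bar R})
  (n_ : nat -> nat) (mu : {measure set OX -> \bar R}).
Hypotheses (Fn_folner : folner R Fn) (nuS : forall n, in_PPE S (nu n))
  (n_inc : increasing_seq n_) (muS : in_PPE S mu).
Hypothesis cvg_mu : forall (f : OX -> R) (N : Omega -> R),
  P.-integrable setT (EFin \o N) -> measurable_fun E f ->
  {ae P, forall w, forall x, E (w, x) -> `|f (w, x)| <= N w} ->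
  {ae P, forall w, {within (fiber E w : set X), continuous (fun x : X => f (w, x))}} ->
  (\int[gavg S (Fn (n_ j)) (nu (n_ j))]_(p in E) (f p)%:E)%E @[j --> \oo] -->
  (\int[mu]_(p in E) (f p)%:E)%E.

Lemma integral_test_invariant g (B : set Omega) (psi : X -> R) :
  measurable B -> continuous psi -> (forall x, 0 <= psi x <= 1) ->
  (\int[mu]_(p in E) (test_function B psi (skew S g p))%:E =
   \int[mu]_(p in E) (test_function B psi p)%:E)%E.
Proof.
move=> mB cpsi psi01; have mE := measurable_bundle S.
set f := test_function B psi.
have mf : measurable_fun setT f by exact: measurable_test_function.
have f01 p : 0 <= f p <= 1 by exact: test_function_bounds.
have mfg : measurable_fun E (fun p => f (skew S g p)).
  exact: measurableT_comp mf (@measurable_skew _ _ _ _ _ _ _ S g).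
have i1 : P.-integrable setT (EFin \o (cst 1 : Omega -> R)).
  exact: finite_measure_integrable_cst.
have f1 p : `|f p| <= 1 by have /andP[? ?] := f01 p; rewrite ger0_norm.
have c1 : (\int[gavg S (Fn (n_ j)) (nu (n_ j))]_(p in E) (f p)%:E)%E @[j --> \oo] -->
    (\int[mu]_(p in E) (f p)%:E)%E.
  apply: (cvg_mu i1).
  - exact: measurable_funTS.
  - by apply: aeW => w x _; exact: f1.
  - apply: aeW => w; apply: continuous_subspaceT => x.
    by apply: cvgM; [exact: cvg_cst|exact: cpsi].
have c2 : (\int[gavg S (Fn (n_ j)) (nu (n_ j))]_(p in E) (f (skew S g p))%:E)%E
    @[j --> \oo] --> (\int[mu]_(p in E) (f (skew S g p))%:E)%E.
  apply: (cvg_mu i1) => //.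
  - by apply: aeW => w x _; exact: f1.
  (* The composed function inherits continuity from [rmap], hence on almost every fiber. *)
  - apply: filterS (bundle_regular S) => w [_ _ cr] x.
    apply: cvgM; first exact: cvg_cst.
    by apply: (cvg_comp _ _ (cr g x)); exact: cpsi.
have [fin1 _] := PPE_integral_unit muS (measurable_funTS mf) f01.
have [fin2 _] := PPE_integral_unit muS mfg (fun p => f01 _).
rewrite -(fineK fin1) -(fineK fin2); congr EFin.
apply/eqP; rewrite -subr_eq0 -normr_le0.
have cd : `|fine (\int[gavg S (Fn (n_ j)) (nu (n_ j))]_(p in E) (f (skew S g p))%:E)%E
   - fine (\int[gavg S (Fn (n_ j)) (nu (n_ j))]_(p in E) (f p)%:E)%E| @[j --> \oo] -->
   `|fine (\int[mu]_(p in E) (f (skew S g p))%:E)%E - fine (\int[mu]_(p in E) (f p)%:E)%E|.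
  by apply: cvg_norm; apply: cvgB; apply: fine_cvg; rewrite fineK.
have [Fn0 Fnr] := Fn_folner.
have rn := increasing_subseq_cvg n_inc (Fnr g).
apply: (ler_cvg_to cd rn); apply: nearW => j; exact: gavg_skew_diff.
Qed.

Lemma limit_invariant : in_PPEG S mu.
Proof.
split => // g; have mE := measurable_bundle S.
have muT : mu setT = 1%E by rewrite -(preimage_setT fst) muS.1// probability_setT.
have gS := in_PPE_gpush muS g.
have gT : gpush S g mu setT = 1%E.
  by rewrite -(preimage_setT fst) gS.1// probability_setT.
apply: test_functions_eq; first by rewrite /= gT ltry.
move=> B psi mB cpsi psi01; have mt := measurable_test_function mB cpsi.
have mt' : measurable_fun setT (EFin \o test_function B psi) by exact/measurable_EFinP.
rewrite (integral_full mE measurableT)// ?setTD; last exact: in_PPE_full gS.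
rewrite [RHS](integral_full mE measurableT)// ?setTD; last exact: in_PPE_full muS.
rewrite ge0_integral_gpush//; first exact: integral_test_invariant.
- exact: measurable_funTS.
- by move=> p _; rewrite lee_fin; have /andP[] := test_function_bounds B p psi01.
Qed.

End invariance.

(** * Strong subadditivity along translates *)

Section modular_minorant.
Context (R : realDomainType) (G : choiceType) (F : {fset G} -> R).
Hypotheses (F0 : F fset0 = 0)
  (Fsub : forall K L, F (K `|` L)%fset + F (K `&` L)%fset <= F K + F L).

(* [c] is the marginal increment of [F] along an enumeration of [A]. *)
Lemma modular_minorant (A : {fset G}) : exists c : G -> R,
  \sum_(x <- A) c x = F A /\
  forall B, (B `<=` A)%fset -> \sum_(x <- B) c x <= F B.
Proof.
elim/finSet_rect: A => A IH.
have [->|/fset0Pn[x xA]] := eqVneq A fset0.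
  exists (fun=> 0); rewrite big_seq_fset0 F0; split => // B.
  by rewrite fsubset0 => /eqP ->; rewrite big_seq_fset0 F0.
have [|c [cA cB]] := IH (A `\ x)%fset; first exact: fproperD1.
have cne (B : {fset G}) z : x \notin B ->
    \sum_(y <- B) (if y == x then z else c y) = \sum_(y <- B) c y.
  move=> xB; rewrite big_seq [RHS]big_seq; apply: eq_bigr => y yB.
  by rewrite ifF//; apply/negP => /eqP yx; rewrite yx (negbTE xB) in yB.
have xD (B : {fset G}) : x \notin (B `\ x)%fset by rewrite !inE eqxx.
exists (fun y => if y == x then F A - F (A `\ x)%fset else c y); split.
  by rewrite (big_fsetD1 x)//= eqxx cne// cA subrK.
move=> B BA; have [xB|xB] := boolP (x \in B); last first.
  by rewrite cne//; apply: cB; rewrite fsubsetD1 BA.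
rewrite (big_fsetD1 x)//= eqxx cne//.
have /cB h : (B `\ x `<=` A `\ x)%fset by exact: fsetSD.
(* Submodularity for [B] and [A] without [x], whose union is [A] and whose intersection is [B]
   without [x]: the increment due to [x] is least at the top. *)
have := Fsub B (A `\ x)%fset.
have -> : (B `|` A `\ x)%fset = A.
  apply/fsetP => y; rewrite !inE; have [->|] := eqVneq y x; first by rewrite xB xA.
  by move=> _ /=; have [/(fsubsetP BA) ->|] := boolP (y \in B).
have -> : (B `&` (A `\ x))%fset = (B `\ x)%fset.
  apply/fsetP => y; rewrite !inE; case: eqVneq => //= _; rewrite ?andbF//.
  by have [/(fsubsetP BA) ->|] := boolP (y \in B).
by move=> le; rewrite addrAC lerBlDr; apply: le_trans le; rewrite lerD2l.
Qed.

End modular_minorant.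

Section translates.
Context (R : realDomainType) (G : groupType).
Implicit Types (K A B : {fset G}) (g k h : G).

Lemma mem_rtrans K g h : (h \in rtrans K g) = ((h * g^-1)%g \in K).
Proof.
apply/imfsetP/idP => [[k kK ->]|hK]; first by rewrite mulgK.
by exists (h * g^-1)%g => //; rewrite mulgVK.
Qed.

Lemma mem_ltrans K g h : (h \in ltrans g K) = ((g^-1 * h)%g \in K).
Proof.
apply/imfsetP/idP => [[k kK ->]|hK]; first by rewrite mulKg.
by exists (g^-1 * h)%g => //; rewrite mulVKg.
Qed.

(** [A] is adjoined so that a sum over [A] can be compared inside the same index set: for [g] in [A]
    the translate [K g] may miss [A]. *)
Definition translate_range K A : {fset G} :=
  (A `|` [fset (k^-1 * h)%g | k in K, h in A])%fset.

(** [K g] contains [h] exactly when [g = k^-1 h] for some [k] in [K], and distinct [k] give distinct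
    [g]. *)
Lemma card_translates_through K A B h : h \in A -> (translate_range K A `<=` B)%fset ->
  #|` [fset g in B | h \in rtrans K g]%fset| = #|` K|.
Proof.
move=> hA AB.
have -> : [fset g in B | h \in rtrans K g]%fset = [fset (k^-1 * h)%g | k in K]%fset.
  apply/fsetP => g; rewrite !inE /= mem_rtrans; apply/andP/imfsetP => /=.
    by move=> [_ hK]; exists (h * g^-1)%g => //; rewrite invgM invgK mulgVK.
  move=> [k kK ->]; rewrite invgM invgK mulVKg; split => //.
  apply: (fsubsetP AB); rewrite !inE; apply/orP; right.
  by apply/imfset2P; exists k => //; exists h.
by rewrite card_imfset//= => k k' /mulIg/invg_inj.
Qed.

(** Submodularity acts only through the additive minorant [c], for which the double sum can be
    exchanged without loss. *)
Lemma translate_cover (F : {fset G} -> R) K A B : F fset0 = 0 ->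
  (forall K L, F (K `|` L)%fset + F (K `&` L)%fset <= F K + F L) ->
  (translate_range K A `<=` B)%fset ->
  #|` K|%:R * F A <= \sum_(g <- B) F (rtrans K g `&` A)%fset.
Proof.
move=> F0 Fsub AB; have [c [cA cS]] := modular_minorant F0 Fsub A.
apply: (@le_trans _ _ (\sum_(g <- B) \sum_(x <- A | x \in rtrans K g) c x)); last first.
  apply: ler_sum => g _; apply: le_trans (cS _ (fsubsetIr _ _)).
  rewrite big_fset_condE/= le_eqVlt; apply/orP; left; apply/eqP.
  by congr (\sum_(x <- enum_fset _) _); apply/fsetP => x; rewrite !inE andbC.
under eq_bigr do rewrite big_mkcond.
rewrite exchange_big/= -cA mulr_sumr big_seq [leRHS]big_seq; apply: ler_sum => x xA.
rewrite -big_mkcond/= big_fset_condE/= big_const_seq count_predT iter_addr_0.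
by rewrite (card_translates_through xA AB) mulr_natl.
Qed.

(* All [g] such that [K g] meets [A] belong to [translate_range K A]. *)
Definition bad_translates K A : {fset G} :=
  [fset g in translate_range K A | ~~ ((g \in A) && (rtrans K g `<=` A)%fset)]%fset.

(** A translate cut by [A] is the translate by the same [g] of a subset of [K], so invariance still
    applies to it. *)
Lemma rtrans_sub K A g : (rtrans K g `&` A)%fset =
  rtrans [fset k in K | (k * g)%g \in A]%fset g.
Proof.
apply/fsetP => x; rewrite !inE !mem_rtrans !inE/= mulgVK.
by [].
Qed.

(** The factor 2: a bad [g] costs up to [N g] for the cut translate, and when [g] lies in [A]
    another [N g] to make up for [a g], which may be as low as [- N g]. *)
Lemma translate_cover_bad (F : {fset G} -> R) (a N : G -> R) K A :
  F fset0 = 0 ->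
  (forall K L, F (K `|` L)%fset + F (K `&` L)%fset <= F K + F L) ->
  (forall g, F (rtrans K g) = a g) ->
  (forall g K', K' != fset0 -> (K' `<=` K)%fset -> F (rtrans K' g) <= N g) ->
  (forall g, `|a g| <= N g) ->
  #|` K|%:R * F A <=
  \sum_(g <- A) a g + \sum_(g <- bad_translates K A) (N g *+ 2).
Proof.
move=> F0 Fsub Fa FN aN; set B := translate_range K A.
have N0 g : 0 <= N g by exact: le_trans (aN g).
apply: (le_trans (translate_cover F0 Fsub (fsubset_refl B))).
have -> : \sum_(g <- A) a g = \sum_(g <- B) if g \in A then a g else 0.
  rewrite -big_mkcond/= [RHS]big_fset_condE/=.
  apply: congr_big => //; congr enum_fset.
  by apply/fsetP => x; rewrite /B !inE; case: (x \in A); rewrite ?andbT ?andbF.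
rewrite /bad_translates -big_fset_condE/= [X in _ <= _ + X]big_mkcond -big_split/=.
apply: ler_sum => g _; have [/andP[gA KA]|] := boolP ((g \in A) && _).
  by rewrite gA addr0 (fsetIidPl KA) Fa.
move=> _; apply: (@le_trans _ _ (N g)).
  have [->|KgA] := eqVneq (rtrans K g `&` A)%fset fset0; first by rewrite F0.
  rewrite rtrans_sub; apply: FN; last first.
    by apply/fsubsetP => k; rewrite !inE => /andP[].
  by apply: contraNneq KgA => K'0; rewrite rtrans_sub K'0 /rtrans imfset0.
case: ifP => _; last by rewrite add0r mulr2n lerDl.
rewrite mulr2n addrA lerDr -lerBlDr sub0r.
by have := aN g; rewrite ler_norml => /andP[].
Qed.

(** For a bad [g] some [k] in [K] has exactly one of [g] and [k g] in [A]: if [g] is in [A], some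
    [k g] leaves it; otherwise [g] is of the form [k^-1 h] with [h] in [A]. *)
Lemma bad_translates_symdiff K A : K != fset0 ->
  (#|` bad_translates K A| <=
   \sum_(k <- K) #|` fsymdiff (ltrans k^-1 A) A|)%N.
Proof.
move=> K0.
have -> : (\sum_(k <- K) #|` fsymdiff (ltrans k^-1 A) A|)%N =
    size (flatten [seq enum_fset (fsymdiff (ltrans k^-1 A) A) | k <- enum_fset K]).
  by rewrite size_flatten /shape -map_comp sumnE big_map.
apply: uniq_leq_size; first exact: fset_uniq.
move=> g; rewrite !inE /= => /andP[gB].
have sd k : k \in K -> ((g \in A) != ((k * g)%g \in A)) ->
    g \in flatten [seq enum_fset (fsymdiff (ltrans k^-1 A) A) | k <- enum_fset K].
  move=> kK ne; apply/flatten_mapP; exists k => //.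
  by rewrite !inE mem_ltrans invgK; move: ne; case: (g \in A); case: (_ \in A).
rewrite negb_and => /orP[gA|/fsubsetPn[x]].
  move: gB; rewrite (negbTE gA)/= => /imfset2P[k kK [h hA gE]].
  by apply: (sd k) => //; rewrite (negbTE gA) gE mulVKg hA.
rewrite mem_rtrans => xK xA.
have [gA|gA] := boolP (g \in A); first by apply: (sd _ xK); rewrite gA mulgVK xA.
move: gB; rewrite (negbTE gA)/= => /imfset2P[k kK [h hA gE]].
by apply: (sd k) => //; rewrite (negbTE gA) gE mulVKg hA.
Qed.

End translates.

Lemma countable_enumeration (G : choiceType) (g0 : G) : countable [set: G] ->
  exists e : nat -> G, forall g, exists n, e n = g.
Proof.
move=> /countable_injP[f finj]; exists (fun n => xget g0 [set g | f g = n]) => g.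
exists (f g); case: xgetP => [h _ /= fh|/(_ g) /= []//].
by apply: finj; rewrite ?inE.
Qed.

(** * The covering inequality along the fibers and its integrated form *)

Section energy_inequality.
Context (G : groupType) (R : realType) d (Omega : measurableType d)
  (P : probability Omega R) (T : mp_action G P) (X : pmetricType R)
  (S : bundle_rds T X).
Local Notation E := (bundle S).
Local Notation OX := (Omega * borel X)%type.
Implicit Types (g h : G) (K : {fset G}) (f : OX -> R) (N : Omega -> R).

Lemma ae_act (Q : Omega -> Prop) g :
  {ae P, forall w, Q w} -> {ae P, forall w, Q (T g w)}.
Proof.
move=> [Z [mZ Z0 QZ]]; exists (T g @^-1` Z); split.
- by rewrite -[X in measurable X]setTI; exact: measurable_act.
- by rewrite act_preserving.
- by move=> w /= nQ; apply: QZ.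
Qed.

Lemma ge0_integral_act (h : Omega -> \bar R) g : measurable_fun setT h ->
  (forall w, 0 <= h w)%E -> (\int[P]_w h (T g w) = \int[P]_w h w)%E.
Proof.
move=> mh h0; have mT : measurable_fun setT (T g) by exact: measurable_act.
have -> : (\int[P]_w h w = \int[pushforward P (T g)]_w h w)%E.
  by apply: eq_measure_integral => A mA _; exact/esym/act_preserving.
by rewrite (ge0_integral_pushforward mT).
Qed.

Lemma integrable_act N g : P.-integrable setT (EFin \o N) ->
  P.-integrable setT (EFin \o (N \o T g)).
Proof.
move=> /integrableP[mN iN]; apply/integrableP; split.
  by apply: (measurableT_comp mN); exact: measurable_act.
have mabs : measurable_fun setT (abse \o (EFin \o N)) by exact: measurableT_comp.
by have /= -> := ge0_integral_act g mabs (fun w => abse_ge0 _).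
Qed.

(** A real, nonnegative version of the supremum: infinite values, such as -oo on an empty fiber,
    become 0. *)
Definition fiber_norm f (w : Omega) : R :=
  `|fine (ereal_sup [set `|f (w, x)|%:E | x in fiber E w])|.

Lemma integrable_fiber_norm f : L1E S f ->
  P.-integrable setT (EFin \o fiber_norm f).
Proof.
move=> [_ _ iS]; apply: (le_integrable measurableT _ _ iS).
  have mS := measurable_int _ iS.
  by apply/measurable_EFinP; apply: measurableT_comp => //; exact: measurableT_comp.
move=> w _; rewrite /fiber_norm /=; case: ereal_sup => [r| |] /=;
  by rewrite ?normr_id ?normr0 ?leey.
Qed.

Lemma fiber_norm_le f : L1E S f ->
  {ae P, forall w, forall x, E (w, x) -> `|f (w, x)| <= fiber_norm f w}.
Proof.
move=> [_ _ iS]; apply: filterS (integrable_ae measurableT iS) => w /(_ I) fin x Ex.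
apply: le_trans (ler_norm _).
rewrite -lee_fin fineK//; apply: ereal_sup_ubound; by exists x.
Qed.

Lemma dominated_integrable (nu : {measure set OX -> \bar R}) f N : in_PPE S nu ->
  measurable_fun E f -> P.-integrable setT (EFin \o N) ->
  {ae P, forall w, forall x, E (w, x) -> `|f (w, x)| <= N w} ->
  nu.-integrable E (EFin \o f).
Proof.
move=> nuS mf iN [Z [mZ Z0 fN]]; have mE := measurable_bundle S.
have nE := in_PPE_full nuS; have mZE := measurable_bundle_restr S mZ.
have mf' : measurable_fun E (EFin \o f) by exact/measurable_EFinP.
apply/integrableP; split => //.
have sub : bundle_restr S Z `<=` E by move=> p [].
rewrite (integral_full mZE mE sub); last first.
- exact: measurableT_comp.
- apply: (subset_measure0 (mu := nu)) (bundle_restr_full nuS.1 nE mZ Z0).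
  + exact: measurableD.
  + exact: measurableC.
  + by move=> p [].
have iNE := integrable_marginal nuS.1 mE nE iN.
have /integrableP[_] := integrableS mE mZE sub iNE.
apply: le_lt_trans; apply: ge0_le_integral => //.
- by apply: measurableT_comp => //; exact: measurable_funS mf'.
- by apply: measurableT_comp => //; have := measurable_int _ iNE; exact: measurable_funS.
- move=> [w x] [Ewx nZw]; rewrite lee_fin.
  have h : forall x, E (w, x) -> `|f (w, x)| <= N w.
    by apply: contrapT => nh; apply: nZw; exact: fN.
  exact: le_trans (h x Ewx) (ler_norm _).
Qed.

Variable D : {fset G} -> OX -> R.
Hypotheses (G_countable : countable [set: G])
  (D_L1 : forall K, K != fset0 -> L1E S (D K))
  (D_subadditive : strongly_subadditive S D) (D_invariant : ginvariant S D).

(** One integrable bound for every set that can remain when a translate of [K] is cut. *)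
Definition subsets_norm K w : R :=
  \sum_(L <- fpowerset K | L != fset0) fiber_norm (D L) w.

Lemma integrable_subsets_norm K : P.-integrable setT (EFin \o subsets_norm K).
Proof.
rewrite (_ : _ \o _ =
    (fun w => \sum_(L <- fpowerset K | L != fset0) (fiber_norm (D L) w)%:E)%E).
  apply: (integrable_sum measurableT) => L L0; exact: integrable_fiber_norm (D_L1 L0).
by apply/funext => w; rewrite /= sumEFin.
Qed.

Lemma subsets_norm_ge K L w : L != fset0 -> (L `<=` K)%fset ->
  fiber_norm (D L) w <= subsets_norm K w.
Proof.
move=> L0 LK; rewrite /subsets_norm -big_filter.
have LF : L \in [seq M <- fpowerset K | M != fset0].
  by rewrite mem_filter L0 fpowersetE.
rewrite (big_rem _ LF)/= lerDl; apply: sumr_ge0 => M _; exact: normr_ge0.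
Qed.

(** A single null set serves all [g] because [G] is countable, and all [L] because [K] has finitely
    many subsets. *)
Lemma subsets_norm_bound K : {ae P, forall w, forall g L x, L != fset0 ->
  (L `<=` K)%fset -> E (T g w, x) -> `|D L (T g w, x)| <= subsets_norm K (T g w)}.
Proof.
have [e eP] := countable_enumeration 1%g G_countable.
have bnd L : L != fset0 -> forall n,
    {ae P, forall w, forall x, E (T (e n) w, x) ->
       `|D L (T (e n) w, x)| <= fiber_norm (D L) (T (e n) w)}.
  by move=> L0 n; exact: ae_act (fiber_norm_le (D_L1 L0)).
have all (s : seq {fset G}) : {ae P, forall w, forall g L x, L \in s -> L != fset0 ->
    E (T g w, x) -> `|D L (T g w, x)| <= fiber_norm (D L) (T g w)}.
  elim: s => [|L s IH]; first exact: aeW.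
  have [L0|L0] := eqVneq L fset0.
    apply: filterS IH => w h g M x; rewrite inE => /orP[/eqP ->|]; last exact: h.
    by rewrite L0 eqxx.
  apply: filterS2 IH (ae_foralln (bnd L L0)) => w h1 h2 g M x.
  rewrite inE => /orP[/eqP -> _|]; last exact: h1.
  by have [n <-] := eP g; exact: h2.
apply: filterS (all (fpowerset K)) => w h g L x L0 LK Ex.
apply: le_trans (subsets_norm_ge (T g w) L0 LK); apply: h => //.
by rewrite fpowersetE.
Qed.

Lemma energy_pointwise K A : K != fset0 -> A != fset0 ->
  {ae P, forall w, forall x, E (w, x) ->
    #|` K|%:R * D A (w, x) <= \sum_(g <- A) D K (skew S g (w, x)) +
      \sum_(g <- bad_translates K A) (subsets_norm K (T g w) *+ 2)}.
Proof.
move=> K0 A0.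
apply: filterS (filterI (subsets_norm_bound K) (filterI D_subadditive D_invariant)).
move=> w [bnd [sub inv]] x Ex.
(* [D] has no meaningful value at [fset0], while the submodular function must vanish there. *)
pose F (L : {fset G}) := if L == fset0 then 0 else D L (w, x).
have FE L : L != fset0 -> F L = D L (w, x) by rewrite /F => /negbTE ->.
have F0 : F fset0 = 0 by rewrite /F eqxx.
have tr0 L g : L != fset0 -> rtrans L g != fset0.
  move=> /fset0Pn[k kL]; apply/fset0Pn; exists (k * g)%g.
  by rewrite mem_rtrans mulgK.
rewrite -(FE A A0); apply: translate_cover_bad => //.
- move=> L M; have [->|L0] := eqVneq L fset0.
    by rewrite fset0U fset0I F0 addrC.
  have [->|M0] := eqVneq M fset0; first by rewrite fsetU0 fsetI0 F0.
  rewrite (FE L)// (FE M)// FE; first exact: sub.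
  by apply: contraNneq L0 => /eqP; rewrite fsetU_eq0 => /andP[].
- by move=> g; rewrite FE ?tr0// inv.
- move=> g L L0 LK; rewrite FE ?tr0// inv//.
  apply: le_trans (ler_norm _) _; apply: bnd => //; exact: (skew_bundle g Ex).
- by move=> g; apply: bnd => //; exact: (skew_bundle g Ex).
Qed.

(** The sum of [D K] along the translates by [A] integrates to [|A|] times the integral against the
    average. All error terms have the same integral, since the marginal of [nu] is [P] and [T g]
    preserves [P]. *)
Lemma energy_inequality (nu : {measure set OX -> \bar R}) K A :
  in_PPE S nu -> K != fset0 -> A != fset0 ->
  (#|` K|%:R * fine (\int[nu]_(p in E) (D A p)%:E)%E <=
   #|` A|%:R * fine (\int[gavg S A nu]_(p in E) (D K p)%:E)%E +
   #|` bad_translates K A|%:R * (fine (\int[P]_w (subsets_norm K w)%:E)%E *+ 2))%R.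
Proof.
move=> nuS K0 A0; have mE := measurable_bundle S.
have mD L : L != fset0 -> measurable_fun E (D L) by move=> /D_L1[].
have mDs L g : L != fset0 -> measurable_fun E (fun p => D L (skew S g p)).
  move=> L0; apply: (measurable_comp mE _ (mD L L0) (@measurable_skew _ _ _ _ _ _ _ S g)).
  by move=> _ [p Ep <-]; exact: skew_bundle.
have iD L : L != fset0 -> nu.-integrable E (EFin \o D L).
  move=> L0; have L1 := D_L1 L0.
  exact: dominated_integrable nuS (mD L L0) (integrable_fiber_norm L1) (fiber_norm_le L1).
have iDs L g : L != fset0 -> nu.-integrable E (fun p => (D L (skew S g p))%:E).
  move=> L0; have L1 := D_L1 L0.
  apply: (dominated_integrable nuS (mDs L g L0)
    (integrable_act g (integrable_fiber_norm L1))).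
  apply: filterS (ae_act g (fiber_norm_le L1)) => w h x Ex.
  by apply: h; exact: (skew_bundle g Ex).
have iN g : P.-integrable setT (EFin \o (subsets_norm K \o T g)).
  exact: integrable_act (integrable_subsets_norm K).
have iNE g : nu.-integrable E (fun p => (subsets_norm K (T g p.1))%:E).
  exact: (integrable_marginal nuS.1 mE (in_PPE_full nuS) (iN g)).
have NE g : (\int[nu]_(p in E) (subsets_norm K (T g p.1))%:E =
    \int[P]_w (subsets_norm K w)%:E)%E.
  rewrite (integral_marginal nuS.1 mE (in_PPE_full nuS) (iN g)).
  apply: (ge0_integral_act (h := fun w => (subsets_norm K w)%:E)).
    exact: (measurable_int _ (integrable_subsets_norm K)).
  by move=> w; rewrite lee_fin; apply: sumr_ge0 => L _; exact: normr_ge0.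
have [Z [mZ Z0 ZE]] := energy_pointwise K0 A0.
have mZE := measurable_bundle_restr S mZ.
have sub : bundle_restr S Z `<=` E by move=> p [].
have full (f : OX -> \bar R) : nu.-integrable E f ->
    (\int[nu]_(p in E) f p = \int[nu]_(p in bundle_restr S Z) f p)%E.
  move=> If; apply: integral_full => //; last exact: measurable_int If.
  apply: (subset_measure0 (mu := nu)) (bundle_restr_full nuS.1 (in_PPE_full nuS) mZ Z0).
  - exact: measurableD.
  - exact: measurableC.
  - by move=> p [].
pose lhs p := (#|` K|%:R%:E * (D A p)%:E)%E.
pose rhs (p : OX) := (\sum_(g <- A) (D K (skew S g p))%:E +
  \sum_(g <- bad_translates K A)
    ((subsets_norm K (T g p.1))%:E + (subsets_norm K (T g p.1))%:E))%E.
have ilhs : nu.-integrable E lhs by apply: integrableZl => //; exact: iD.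
have irhs1 : nu.-integrable E (fun p => \sum_(g <- A) (D K (skew S g p))%:E)%E.
  by apply: integrable_sum => // g _; exact: iDs.
have irhs2 : nu.-integrable E (fun p => \sum_(g <- bad_translates K A)
    ((subsets_norm K (T g p.1))%:E + (subsets_norm K (T g p.1))%:E))%E.
  by apply: integrable_sum => // g _; apply: integrableD.
have irhs : nu.-integrable E rhs by exact: integrableD.
have le : (\int[nu]_(p in E) lhs p <= \int[nu]_(p in E) rhs p)%E.
  rewrite (full _ ilhs) (full _ irhs); apply: le_integral => //.
  - exact: integrableS ilhs.
  - exact: integrableS irhs.
  move=> [w x]; rewrite inE => -[Ewx nZw]; rewrite /lhs /rhs -EFinM !sumEFin -EFinD lee_fin.
  have h : forall x, E (w, x) ->
      #|` K|%:R * D A (w, x) <= \sum_(g <- A) D K (skew S g (w, x)) +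
      \sum_(g <- bad_translates K A) (subsets_norm K (T g w) *+ 2).
    by apply: contrapT => nh; apply: nZw; exact: ZE.
  exact: h.
move: le; rewrite integralZl//; last exact: iD.
rewrite integralD// integral_sum//; last by move=> g; exact: iDs.
rewrite integral_sum//; last by move=> g; exact: integrableD.
under [X in (_ <= _ + X)%E]eq_bigr do rewrite integralD// NE.
have cfin := integrable_fin_num measurableT (integrable_subsets_norm K).
have DAfin := integrable_fin_num mE (iD A A0).
pose J g := fine (\int[nu]_(p in E) (D K (skew S g p))%:E)%E.
have JE g : (\int[nu]_(p in E) (D K (skew S g p))%:E)%E = (J g)%:E.
  by rewrite /J fineK//; apply: (integrable_fin_num mE); exact: iDs.
rewrite -(fineK DAfin) -(fineK cfin).
rewrite [X in (_ <= X + _)%E](eq_bigr (fun g => (J g)%:E)); last first.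
  by move=> g _; exact: JE.
under [X in (_ <= _ + X)%E]eq_bigr do rewrite -EFinD -mulr2n.
rewrite !sumEFin -EFinM -EFinD lee_fin => /le_trans; apply.
rewrite (integral_gavg nuS A (mD K K0)); last by move=> g; exact: iDs.
rewrite (eq_bigr (fun g => (J g)%:E)); last by move=> g _; exact: JE.
rewrite sumEFin -EFinM/= mulrA divff ?pnatr_eq0 ?cardfs_eq0// mul1r lerD2l.
by rewrite big_const_seq count_predT iter_addr_0 mulr_natl.
Qed.

End energy_inequality.

Lemma le_limn_esup (R : realType) (u v : nat -> \bar R) :
  (forall n, u n <= v n)%E -> (limn_esup u <= limn_esup v)%E.
Proof.
move=> uv; rewrite -leeN2 -!limn_einfN; apply: le_limn_einf => n /=.
by rewrite leeN2.
Qed.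

Section limsup_energy.
Context (G : groupType) (R : realType) d (Omega : measurableType d)
  (P : probability Omega R) (T : mp_action G P) (X : pmetricType R)
  (S : bundle_rds T X).
Local Notation E := (bundle S).
Local Notation OX := (Omega * borel X)%type.
Variable D : {fset G} -> OX -> R.
Hypotheses (G_countable : countable [set: G])
  (D_L1 : forall K, K != fset0 -> L1E S (D K))
  (D_subadditive : strongly_subadditive S D) (D_invariant : ginvariant S D).

Lemma integrable_PPE (nu : {measure set OX -> \bar R}) K : in_PPE S nu -> K != fset0 ->
  nu.-integrable E (EFin \o D K).
Proof.
move=> nuS /D_L1 L1; have [mD _ _] := L1.
exact: dominated_integrable nuS mD (integrable_fiber_norm L1) (fiber_norm_le L1).
Qed.

Lemma folner_bad_translates (F : nat -> {fset G}) K : folner R F -> K != fset0 ->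
  (#|` bad_translates K (F j)|%:R / #|` F j|%:R : R) @[j --> \oo] --> (0 : R).
Proof.
move=> [F0 Fr] K0.
pose r k j : R := #|` fsymdiff (ltrans k^-1%g (F j)) (F j)|%:R / #|` F j|%:R.
have rs : (\sum_(k <- K) r k j) @[j --> \oo] --> (0 : R).
  elim: (enum_fset K) => [|k s IH].
    by under eq_fun do rewrite big_nil; exact: cvg_cst.
  under eq_fun do rewrite big_cons.
  have := cvgD (Fr k^-1%g) IH; rewrite addr0; exact.
apply: (squeeze_cvgr _ (cvg_cst 0) rs); apply: nearW => j.
rewrite divr_ge0//= /r -mulr_suml ler_wpM2r ?invr_ge0// -natr_sum ler_nat.
exact: bad_translates_symdiff.
Qed.

Lemma limsup_energy (F : nat -> {fset G}) (nu : nat -> {measure set OX -> \bar R})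
    (mu : {measure set OX -> \bar R}) K :
  folner R F -> (forall j, in_PPE S (nu j)) -> in_PPE S mu -> K != fset0 ->
  (\int[gavg S (F j) (nu j)]_(p in E) (D K p)%:E)%E @[j --> \oo] -->
    (\int[mu]_(p in E) (D K p)%:E)%E ->
  (limn_esup (fun j => (#|` F j|%:R^-1)%:E * \int[nu j]_(p in E) (D (F j) p)%:E) <=
   (#|` K|%:R^-1)%:E * \int[mu]_(p in E) (D K p)%:E)%E.
Proof.
move=> Ffol nuS muS K0 cK; have mE := measurable_bundle S.
have F0 j : F j != fset0 by case: Ffol.
have cardgt0 (A : {fset G}) : A != fset0 -> 0 < #|` A|%:R :> R.
  by move=> A0; rewrite ltr0n cardfs_gt0.
have fin (m : {measure set OX -> \bar R}) A : in_PPE S m -> A != fset0 ->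
    (\int[m]_(p in E) (D A p)%:E)%E \is a fin_num.
  by move=> mS A0; exact: (integrable_fin_num mE (integrable_PPE mS A0)).
pose c := fine (\int[P]_w (subsets_norm S D K w)%:E)%E *+ 2.
pose y j := fine (\int[gavg S (F j) (nu j)]_(p in E) (D K p)%:E)%E.
(* The right-hand side of [energy_inequality] divided by [|K| |F j|]; as [K] is fixed, the
   coefficient of [c] tends to 0. *)
pose z j := #|` K|%:R^-1 * (y j + (#|` bad_translates K (F j)|%:R / #|` F j|%:R) * c).
have cz : (z j)%:E @[j --> \oo] -->
    ((#|` K|%:R^-1)%:E * \int[mu]_(p in E) (D K p)%:E)%E.
  rewrite -(fineK (fin _ _ muS K0)) -EFinM; apply: cvg_EFin; first exact: nearW.
  apply: cvgM; first exact: cvg_cst.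
  rewrite -[fine _]addr0; apply: cvgD.
    by apply: fine_cvg; rewrite fineK// fin.
  by rewrite -(mul0r c); apply: cvgM; [exact: folner_bad_translates|exact: cvg_cst].
rewrite -(cvg_limn_einf_sup cz).2; apply: le_limn_esup => j.
rewrite -(fineK (fin _ _ (nuS j) (F0 j))) -EFinM lee_fin /z.
have := energy_inequality G_countable D_L1 D_subadditive D_invariant (nuS j) K0 (F0 j).
rewrite -/c -/(y j) => le.
rewrite ler_pdivlMl ?cardgt0// mulrCA ler_pdivrMl ?cardgt0//.
by rewrite mulrDr mulrA mulrCA mulfV ?mulr1// gt_eqF// cardgt0.
Qed.

End limsup_energy.

(** * Comparison of the upper limit with the mean value *)

Theorem proposition9p1 (R : realType) (G : groupType)
  (G_infinite : infinite_set [set: G]) (G_countable : countable [set: G])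
  (Fn : nat -> {fset G}) (Fn_folner : folner R Fn)
  (Fn_unit : 1%g \in Fn 0%N) (Fn_proper : forall n, (Fn n `<` Fn n.+1)%fset)
  (dO : measure_display) (Omega : measurableType dO) (P : probability Omega R)
  (P_lebesgue : lebesgue_space P) (T : mp_action G P)
  (X : pmetricType R) (X_compact : compact [set: X])
  (S : bundle_rds T X)
  (D : {fset G} -> Omega * borel X -> R)
  (D_L1 : forall K, K != fset0 -> L1E S (D K))
  (D_subadditive : strongly_subadditive S D) (D_invariant : ginvariant S D)
  (nu : nat -> probability (Omega * borel X)%type R)
  (nu_PPE : forall n, in_PPE S (nu n)) :
  exists (n_ : nat -> nat) (mu : probability (Omega * borel X)%type R),
    [/\ increasing_seq n_,
        cvg_PPE S (fun j => gavg S (Fn (n_ j)) (nu (n_ j))) mu,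
        in_PPEG S mu &
        (limn_esup (fun j => (#|` Fn (n_ j)|%:R^-1)%:E *
            \int[nu (n_ j)]_(p in bundle S) (D (Fn (n_ j)) p)%:E)
         <= mean_value S Fn D mu)%E].

Proof.
have [Fn0 Fnr] := Fn_folner; have mE := measurable_bundle S.
have [n_ n_inc [mu [muS cvg_mu]]] :=
  bundle_compactness P_lebesgue X_compact (fun n => in_PPE_gavg (nu_PPE n) (Fn0 n)).
have muG : in_PPEG S mu := limit_invariant Fn_folner nu_PPE n_inc muS cvg_mu.
have cmu : cvg_PPE S (fun j => gavg S (Fn (n_ j)) (nu (n_ j))) mu.
  move=> f L1; have [mf cf _] := L1.
  apply: cvg_mu (integrable_fiber_norm L1) mf (fiber_norm_le L1) _.
  exact/aeW.
exists n_, mu; split => //.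
have Fol : folner R (Fn \o n_).
  by split=> [j|g] /=; [exact: Fn0|exact: increasing_subseq_cvg n_inc (Fnr g)].
pose b m := ((#|` Fn m|%:R^-1)%:E * \int[mu]_(p in bundle S) (D (Fn m) p)%:E)%E.
(* [K] is [Fn m] for every [m], not just along the subsequence, so the bound meets all terms of the
   sequence defining [mean_value]. *)
have le_b m := limsup_energy G_countable D_L1 D_subadditive D_invariant Fol
  (fun j => nu_PPE (n_ j)) muS (Fn0 m) (cmu _ (D_L1 _ (Fn0 m))).
have gavg_mu m K : K != fset0 ->
    (\int[gavg S K mu]_(p in bundle S) (D (Fn m) p)%:E =
     \int[mu]_(p in bundle S) (D (Fn m) p)%:E)%E.
  move=> K0; apply: eq_measure_integral => A mA _; rewrite /= /gavg.
  rewrite (eq_bigr (fun=> mu A)); last by move=> g _; exact: muG.2.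
  rewrite -[mu A]fineK ?fin_num_measure// sumEFin -EFinM.
  rewrite big_const_seq count_predT iter_addr_0 -(mulr_natl (fine _)) mulKf//.
  by rewrite pnatr_eq0 cardfs_eq0.
(* [limsup_energy] for the constant sequence [mu], equal to its own averages;
   this shows that the sequence defining [mean_value] converges. *)
have b_le m : (limn_esup b <= b m)%E.
  apply: (limsup_energy G_countable D_L1 D_subadditive D_invariant Fn_folner
    (fun=> muS) muS (Fn0 m)).
  under eq_fun do rewrite gavg_mu//.
  exact: cvg_cst.
have cb : b @ \oo --> limn_einf b.
  (* An upper limit below every term is below the lower limit. *)
  by apply: squeeze_limn_einf_esup => //; apply: ge_limn_einf; exact: nearW.
rewrite /mean_value (cvg_lim _ cb)//.
by apply: ge_limn_einf; apply: nearW => m; exact: le_b.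
Qed.
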